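(* Let $(\mathfrak g,\mathfrak t_0^e)$ be a standard affinisation of a simple (infinite-dimensional) Hilbert--Lie algebra, with Weyl group $\widehat{\mathcal W}=\mathcal W(\mathfrak g,\mathfrak t_0^e)$. Let $\lambda=(\lambda_c,\lambda^0,\lambda_d)\in i(\mathfrak t_0^e)^*$ be an integral weight with $\lambda_c\neq 0$. Then for any character $\chi=(\chi_c,\chi^0,\chi_d)\colon i(\mathfrak t_0^e)^*\to\mathbb R$ with $\lambda_c\chi_d>0$, the following are equivalent: (1) $\inf\big(\chi(\widehat{\mathcal W}.\lambda-\lambda)\big)>-\infty$. (2) $\chi=\chi_{\min}+\chi_{\mathrm{sum}}$ for some minimal energy character $\chi_{\min}$, i.e. a character satisfying $\inf\big(\chi_{\min}(\widehat{\mathcal W}.\lambda-\lambda)\big)=0$, and some summable character $\chi_{\mathrm{sum}}$.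
   Context: A Hilbert--Lie algebra $\mathfrak k$ is a real Lie algebra with a real Hilbert space structure whose scalar product satisfies $\langle[x,y],z\rangle=\langle x,[y,z]\rangle$. Let $\mathfrak k$ be a simple infinite-dimensional Hilbert--Lie algebra, $\varphi\in\mathrm{Aut}(\mathfrak k)$ of finite order $N$, $\mathfrak t_0$ a maximal abelian subalgebra of $\mathfrak k^\varphi=\{x:\varphi(x)=x\}$, and $\Delta_\varphi\subseteq i\mathfrak t_0^*$ the set of nonzero weights (roots) of $\mathfrak t_0$ on $\mathfrak k_{\mathbb C}$. Loop algebra: $\mathcal L_\varphi(\mathfrak k)=\{\xi\in C^\infty(\mathbb R,\mathfrak k): \xi(t+\tfrac{2\pi}{N})=\varphi^{-1}(\xi(t))\ \forall t\in\mathbb R\}$, with $\langle\xi,\eta\rangle=\frac1{2\pi}\int_0^{2\pi}\langle\xi(t),\eta(t)\rangle\,dt$. Put $D_0\xi=\xi'$ and $\omega_{D_0}(\xi,\eta)=\langle D_0\xi,\eta\rangle$. The unslanted $\varphi$-twisted affinisation of $\mathfrak k$ is $\mathfrak g=\widehat{\mathcal L}^0_\varphi(\mathfrak k)=\mathbb R\times\mathcal L_\varphi(\mathfrak k)\times\mathbb R$ with bracket $[(z_1,x_1,t_1),(z_2,x_2,t_2)]=(\omega_{D_0}(x_1,x_2),[x_1,x_2]+t_1D_0x_2-t_2D_0x_1,0)$. It has the maximal abelian subalgebra $\mathfrak t_0^e=\mathbb R\oplus\mathfrak t_0\oplus\mathbb R$. Set $\mathbf c=(i,0,0)$, $\mathbf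 d=(0,0,-i)$ in $i\mathfrak t_0^e\subseteq\mathfrak g_{\mathbb C}$. An element $\mu\in i(\mathfrak t_0^e)^*$ (a real-valued linear functional on $i\mathfrak t_0^e$) is written $\mu=(\mu_c,\mu^0,\mu_d)$ with $\mu_c=\mu(\mathbf c)$, $\mu^0=\mu|_{i\mathfrak t_0}$, $\mu_d=\mu(\mathbf d)$. The compact roots of $(\mathfrak g,\mathfrak t_0^e)$ are the roots with nonzero restriction to $i\mathfrak t_0$; they have the form $(0,\alpha,n)$ with $\alpha\in\Delta_\varphi$, $n\in\mathbb Z$. Standard affinisations: $\mathfrak g=\widehat{\mathcal L}^0_\varphi(\mathfrak k)$ with either $\varphi=\mathrm{id}$, or $\varphi$ one of three standard automorphisms $\psi_Y$ of order $2$ ($Y\in\{B,C,BC\}$) of suitable $\mathfrak k$. In each case there are an infinite set $J$ and an orthonormal basis $\{e_j\}_{j\in J}$ of $i\mathfrak t_0$ (for suitably normalised scalar product) such that, with $\epsilon_j\in i\mathfrak t_0^*$ given by $\epsilon_j(e_k)=\delta_{jk}$, the set of compact roots, viewed as a set of pairs $(\alpha,n)$, is one of $A_J^{(1)},B_J^{(1)},C_J^{(1)},D_J^{(1)}$ (when $\varphi=\mathrm{id}$), where $X_J^{(1)}=X_J\times\mathbb Z$; $B_J^{(2)}=(B_J\times2\mathbb Z)\cup(\{\pm\epsilon_j\}\times(2\mathbb Z+1))$; $C_J^{(2)}=(C_J\times2\mathbb Z)\cup(D_J\times(2\mathbb Z+1))$; $BC_J^{(2)}=(B_J\times2\mathbb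 Z)\cup(BC_J\times(2\mathbb Z+1))$ (when $\varphi=\psi_Y$, type $Y_J^{(2)}$). Here, with $j\ne k$ in $J$: $A_J=\{\epsilon_j-\epsilon_k\}$, $D_J=\{\pm(\epsilon_j\pm\epsilon_k)\}$, $B_J=D_J\cup\{\pm\epsilon_j\}$, $C_J=D_J\cup\{\pm2\epsilon_j\}$, $BC_J=B_J\cup C_J$. The coroot of a compact root $\gamma=(0,\alpha,n)$ is $\gamma^\vee=\big(\tfrac{-2n}{(\alpha,\alpha)},\tfrac{2}{(\alpha,\alpha)}\alpha^\sharp,0\big)$, meaning $\tfrac{-2n}{(\alpha,\alpha)}\mathbf c+\tfrac2{(\alpha,\alpha)}\alpha^\sharp$, where $(\epsilon_j,\epsilon_k)=\delta_{jk}$ and $\sharp$ is linear with $\epsilon_j^\sharp=e_j$. The Weyl group $\widehat{\mathcal W}$ is generated by the reflections $r_\gamma(\mu)=\mu-\mu(\gamma^\vee)\gamma$ of $i(\mathfrak t_0^e)^*$, $\gamma$ compact. A weight $\lambda$ is integral if $\lambda(\gamma^\vee)\in\mathbb Z$ for all compact roots $\gamma$. A character $\chi\colon i(\mathfrak t_0^e)^*\to\mathbb R$ is a linear functional, written $\chi=(\chi_c,\chi^0,\chi_d)$ with $\chi_c=\chi((1,0,0))$, $\chi^0=\chi|_{i\mathfrak t_0^*}$, $\chi_d=\chi((0,0,1))$. It is summable if $\chi_c=\chi_d=0$ and $\sum_{j\in J}|\chi^0(\epsilon_j)|<\infty$. *)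

(* Defs.v *)
From HB Require Import structures.
From mathcomp Require Import all_boot all_order all_algebra.
From mathcomp Require Import all_classical all_reals all_analysis.
From mathcomp Require Import ring.

Set Implicit Arguments.
Unset Strict Implicit.
Unset Printing Implicit Defensive.

Import Order.TTheory GRing.Theory Num.Theory.
Import numFieldNormedType.Exports.

Local Open Scope classical_set_scope.
Local Open Scope ring_scope.

Section Subspace.
Variables (R : pzRingType) (V : lmodType R) (S : submodClosed V).

Definition subspace : Type := {x : V | x \in S}.

HB.instance Definition _ := SubChoice.on subspace.
HB.instance Definition _ := [SubChoice_isSubLmodule of subspace by <:].
End Subspace.

(* The algebraic dual: functionals are not required to be continuous. *)
Section Dual.
Variables (R : realType) (V : lmodType R).

Definition linear_pred : {pred V -> R^o} := fun f => `[< linear f >].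

Lemma linear_pred_submod : submod_closed linear_pred.
Proof.
split=> [|a f g].
  by apply/asboolP => b x y; rewrite scaler0 add0r.
move=> /asboolP fL /asboolP gL; apply/asboolP => b x y.
rewrite /= !fctE fL gL !scalerDr !scalerA (mulrC a b).
by rewrite -!addrA; congr (_ + _); rewrite addrCA.
Qed.

HB.instance Definition _ :=
  GRing.isSubmodClosed.Build R (V -> R^o) linear_pred linear_pred_submod.

Definition dual : Type := subspace linear_pred.
HB.instance Definition _ := GRing.Lmodule.on dual.

Definition fun_of_dual (f : dual) : V -> R := val f.
Coercion fun_of_dual : dual >-> Funclass.

Definition mk_dual (f : V -> R) (fL : linear (f : V -> R^o)) : dual :=
  exist _ (f : V -> R^o) (introT (asboolP _) fL).
End Dual.

(* The norm of [k] is the one of the scalar product, so [k] is a real Hilbert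
   space. *)
Record hilbert_lie (R : realType) (k : completeNormedModType R) := HilbertLie {
  ip : k -> k -> R;
  br : k -> k -> k;
  ip_linear : forall z : k, linear (fun x => ip x z : R^o);
  ip_sym : forall x y : k, ip x y = ip y x;
  ip_norm : forall x : k, ip x x = `|x| ^+ 2;
  br_linear : forall z : k, linear (fun x => br x z);
  br_alt : forall x : k, br x x = 0;
  br_jacobi : forall x y z : k, br x (br y z) + br y (br z x) + br z (br x y) = 0;
  ip_invariant : forall x y z : k, ip (br x y) z = ip x (br y z)
}.

Section HilbertLie.
Variables (R : realType) (k : completeNormedModType R) (L : hilbert_lie k).

Definition infinite_dimensional : Prop :=
  forall (n : nat) (v : 'I_n -> k),
    exists x : k, forall a : 'I_n -> R, x <> \sum_(i < n) a i *: v i.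

(* Only closed ideals count: in an infinite-dimensional Hilbert-Lie algebra the
   finite rank operators typically form a proper dense ideal. *)
Definition simple_hilbert_lie : Prop :=
  (exists x y : k, br L x y <> 0) /\
  forall I : submodClosed k,
    closed [set x : k | x \in I] ->
    (forall x y : k, y \in I -> br L x y \in I) ->
    (forall x : k, x \in I -> x = 0) \/ (forall x : k, x \in I).

Definition hilbert_lie_aut (phi : {linear k -> k}) : Prop :=
  [/\ bijective phi,
      forall x y : k, phi (br L x y) = br L (phi x) (phi y) &
      forall x y : k, ip L (phi x) (phi y) = ip L x y].

Definition map_has_order (phi : k -> k) (N : nat) : Prop :=
  [/\ (0 < N)%N,
      forall x : k, iter N phi x = x &
      forall m : nat, (0 < m < N)%N -> exists x : k, iter m phi x <> x].

Definition abelian_in_fixed (phi : k -> k) (S : submodClosed k) : Prop :=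
  (forall x : k, x \in S -> phi x = x) /\
  (forall x y : k, x \in S -> y \in S -> br L x y = 0).

Definition maximal_abelian_in_fixed (phi : k -> k) (S : submodClosed k) : Prop :=
  abelian_in_fixed phi S /\
  forall S' : submodClosed k, {subset S <= S'} -> abelian_in_fixed phi S' ->
    {subset S' <= S}.

End HilbertLie.

(* The affinisation and its complexification are carved out, by the predicates
   [in_aff] and [in_affC], of the spaces [pre_aff] and [pre_affC] in which the
   middle component is an arbitrary function R -> k; the bracket is given by
   the same formula on all of [pre_aff].  A pair (a, b) stands for a + i b. *)
Section Affinisation.
Variables (R : realType) (k : completeNormedModType R) (L : hilbert_lie k).
Variables (phi : k -> k) (N : nat) (t0 : submodClosed k).

Definition smooth (xi : R -> k) : Prop :=
  forall (n : nat) (t : R), derivable (derive1n n xi) t 1.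

(* For invertible [phi], the second clause is
   xi (t + 2 pi / N) = phi^-1 (xi t). *)
Definition twisted_loop (xi : R -> k) : Prop :=
  smooth xi /\ forall t : R, phi (xi (t + 2 * pi / N%:R)) = xi t.

Definition loop_ip (xi eta : R -> k) : R :=
  (2 * pi)^-1 *
  (\int[lebesgue_measure]_(t in `[0, 2 * pi]) ip L (xi t) (eta t))%R.

Definition omega_D0 (xi eta : R -> k) : R := loop_ip (derive1 xi) eta.

Definition pre_aff : lmodType R := (R^o * (R -> k) * R^o)%type.
Definition pre_affC : lmodType R := (pre_aff * pre_aff)%type.

Definition in_aff (u : pre_aff) : Prop := twisted_loop u.1.2.
Definition in_affC (u : pre_affC) : Prop := in_aff u.1 /\ in_aff u.2.

Definition aff_br (u v : pre_aff) : pre_aff :=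
  (omega_D0 u.1.2 v.1.2,
   (fun s => br L (u.1.2 s) (v.1.2 s) + u.2 *: derive1 v.1.2 s - v.2 *: derive1 u.1.2 s),
   0).

Definition affC_br (u v : pre_affC) : pre_affC :=
  (aff_br u.1 v.1 - aff_br u.2 v.2, aff_br u.1 v.2 + aff_br u.2 v.1).

(* The real vector spaces i t_0 and i t_0^e are coordinatised by t_0 and t_0^e:
   [h : it0] stands for i h, and [w : it0e] stands for i w. *)
Definition it0 : lmodType R := subspace t0.
Definition it0e : lmodType R := (R^o * it0 * R^o)%type.

Definition it0e_in_affC (w : it0e) : pre_affC :=
  (0, (w.1.1, fun=> val w.1.2, w.2)).

Definition cc : it0e := (1, 0, 0).
Definition dd : it0e := (0, 0, -1).
Definition of_it0 (h : it0) : it0e := (0, h, 0).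

Lemma triple_linear (a : R) (alpha : dual it0) (b : R) :
  linear ((fun w : it0e => w.1.1 * a + alpha w.1.2 - w.2 * b) : it0e -> R^o).
Proof.
case: alpha => alpha alphaL c w v; have /asboolP lin := alphaL.
rewrite /fun_of_dual /= lin /GRing.scale /=; ring.
Qed.

(* The functional (a, alpha, b): a on c, alpha on i t_0, b on d = (0, 0, -i). *)
Definition triple (a : R) (alpha : dual it0) (b : R) : dual it0e :=
  mk_dual (triple_linear a alpha b).

Lemma restr_linear (mu : dual it0e) :
  linear ((fun h => mu (of_it0 h)) : it0 -> R^o).
Proof.
case: mu => mu muL a h h' /=; have /asboolP lin := muL.
rewrite /fun_of_dual /= -lin /of_it0; congr (mu _).
by congr (_, _, _); rewrite /= addr0 /GRing.scale /= mulr0.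
Qed.

Definition wt_c (mu : dual it0e) : R := mu cc.
Definition wt_0 (mu : dual it0e) : dual it0 := mk_dual (restr_linear mu).
Definition wt_d (mu : dual it0e) : R := mu dd.

Definition root_vector (gamma : dual it0e) (u : pre_affC) : Prop :=
  in_affC u /\
  forall w : it0e, affC_br (it0e_in_affC w) u = gamma w *: u.

Definition is_root (gamma : dual it0e) : Prop :=
  gamma <> 0 /\ exists u : pre_affC, u <> 0 /\ root_vector gamma u.

Definition compact_root (gamma : dual it0e) : Prop :=
  is_root gamma /\ wt_0 gamma <> 0.

Definition char_c (chi : dual (dual it0e)) : R := chi (triple 1 0 0).
Definition char_0 (chi : dual (dual it0e)) (alpha : dual it0) : R :=
  chi (triple 0 alpha 0).
Definition char_d (chi : dual (dual it0e)) : R := chi (triple 0 0 1).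

Section Basis.
Variables (kappa : R) (J : choiceType) (e : J -> it0).

(* The normalised scalar product on i t_0 is [kappa] times the hermitian
   extension of the scalar product of k; note that <i x, i y> = <x, y>. *)
Definition orthonormal_basis : Prop :=
  (forall i j : J, kappa * ip L (val (e i)) (val (e j)) = (i == j)%:R) /\
  [set x : k | x \in t0] =
  closure [set x : k | exists (s : seq J) (a : J -> R),
                         x = \sum_(j <- s) a j *: val (e j)].

Lemma eps_linear (j : J) :
  linear ((fun h => kappa * ip L (val (e j)) (val h)) : it0 -> R^o).
Proof.
move=> a h h'; rewrite (ip_sym L (val (e j)) (val (a *: h + h'))).
rewrite !(ip_sym L (val (e j))) linearP /= (ip_linear L (val (e j)) a).
by rewrite mulrDr -scalerAr.
Qed.

Definition eps (j : J) : dual it0 := mk_dual (eps_linear j).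

Definition roots_A : set (dual it0) :=
  [set a | exists i j : J, i <> j /\ a = eps i - eps j].
Definition roots_D : set (dual it0) :=
  [set a | exists i j : J, i <> j /\
     [\/ a = eps i + eps j, a = - (eps i + eps j),
         a = eps i - eps j | a = - (eps i - eps j)]].
Definition roots_short : set (dual it0) :=
  [set a | exists j : J, a = eps j \/ a = - eps j].
Definition roots_long : set (dual it0) :=
  [set a | exists j : J, a = eps j *+ 2 \/ a = - (eps j *+ 2)].
Definition roots_B : set (dual it0) := roots_D `|` roots_short.
Definition roots_C : set (dual it0) := roots_D `|` roots_long.
Definition roots_BC : set (dual it0) := roots_B `|` roots_C.

End Basis.
End Affinisation.

Variant aff_type := A1 | B1 | C1 | D1 | B2 | C2 | BC2.

Definition untwisted (X : aff_type) : bool :=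
  match X with A1 | B1 | C1 | D1 => true | B2 | C2 | BC2 => false end.

Definition evenz : set int := [set n | (2 %| n)%Z].
Definition oddz : set int := ~` evenz.

Section Standard.
Variables (R : realType) (k : completeNormedModType R) (L : hilbert_lie k).
Variables (phi : k -> k) (N : nat) (t0 : submodClosed k).
Variables (kappa : R) (J : choiceType) (e : J -> it0 t0).

Definition aff_roots (X : aff_type) : set (dual (it0 t0) * int) :=
  match X with
  | A1 => roots_A L kappa e `*` setT
  | B1 => roots_B L kappa e `*` setT
  | C1 => roots_C L kappa e `*` setT
  | D1 => roots_D L kappa e `*` setT
  | B2 => (roots_B L kappa e `*` evenz) `|` (roots_short L kappa e `*` oddz)
  | C2 => (roots_C L kappa e `*` evenz) `|` (roots_D L kappa e `*` oddz)
  | BC2 => (roots_B L kappa e `*` evenz) `|` (roots_BC L kappa e `*` oddz)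
  end.

(* Among the order 2 automorphisms, the standard ones are singled out by the
   root system of the pair (g, t_0^e). *)
Record standard_affinisation (X : aff_type) : Prop := StandardAffinisation {
  std_aut : if untwisted X then forall x : k, phi x = x else N = 2%N;
  std_infinite : infinite_set [set: J];
  std_normalised : 0 < kappa;
  std_basis : orthonormal_basis L kappa e;
  std_roots : [set gamma | compact_root L phi N (t0 := t0) gamma] =
              [set triple 0 p.1 p.2%:~R | p in aff_roots X]
}.

(* On finite linear combinations of the eps_j, the form with
   (eps_i, eps_j) = delta_ij and the linear map with eps_j |-> e_j;
   the sums have finite support there, as alpha = sum_j alpha (e_j) eps_j. *)
Definition form (alpha beta : dual (it0 t0)) : R :=
  \sum_(j \in [set: J]) alpha (e j) * beta (e j).
Definition sharp (alpha : dual (it0 t0)) : it0 t0 :=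
  \sum_(j \in [set: J]) alpha (e j) *: e j.

Definition coroot (gamma : dual (it0e t0)) : it0e t0 :=
  let alpha := wt_0 gamma in let n := wt_d gamma in
  (- 2 * n / form alpha alpha) *: cc t0 +
  of_it0 ((2 / form alpha alpha) *: sharp alpha).

Definition reflection (gamma mu : dual (it0e t0)) : dual (it0e t0) :=
  mu - mu (coroot gamma) *: gamma.

Inductive weyl : (dual (it0e t0) -> dual (it0e t0)) -> Prop :=
| weyl_refl gamma of compact_root L phi N gamma : weyl (reflection gamma)
| weyl_id : weyl id
| weyl_comp w w' of weyl w & weyl w' : weyl (w \o w')
| weyl_inv w w' of weyl w & cancel w w' & cancel w' w : weyl w'.

Definition integral_weight (lambda : dual (it0e t0)) : Prop :=
  forall gamma, compact_root L phi N gamma -> lambda (coroot gamma) \is a Num.int.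

(* inf (chi (W.lambda - lambda)), taken in the extended reals. *)
Definition inf_energy (lambda : dual (it0e t0)) (chi : dual (dual (it0e t0))) :
    \bar R :=
  ereal_inf [set (chi (w lambda - lambda))%:E | w in [set w | weyl w]].

Definition minimal_energy (lambda : dual (it0e t0))
    (chi : dual (dual (it0e t0))) : Prop :=
  inf_energy lambda chi = 0%E.

Definition summable_char (chi : dual (dual (it0e t0))) : Prop :=
  [/\ char_c chi = 0, char_d chi = 0 &
      summable [set: J] (fun j => (char_0 chi (eps L kappa e j))%:E)].

End Standard.

(* Main.v *)
Require Import Defs.
From HB Require Import structures.
From mathcomp Require Import all_boot all_order all_algebra.
From mathcomp Require Import all_classical all_reals all_analysis.
From mathcomp Require Import ring lra zify.

Set Implicit Arguments.
Unset Strict Implicit.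
Unset Printing Implicit Defensive.

Import Order.TTheory GRing.Theory Num.Theory.
Import numFieldNormedType.Exports.
Local Open Scope classical_set_scope.
Local Open Scope ring_scope.

(** Why the theorem is true.

    Write l_j = lambda(e_j), c = lambda_c, chi_j = chi(eps_j), a = chi_d / c,
    which is positive, and y_j = - chi_j / a.  A reflection changes finitely
    many of the coordinates b_j on e_j, it fixes the central one, and the
    change of the last coordinate is dictated by the invariant quadratic form.
    So a weight mu of the orbit is determined by b ([weight_at],
    [reflection_weight_at]), and
      chi (mu - lambda) = a * sum_j ((b_j - y_j)^2 - (l_j - y_j)^2) / 2,
    that is a times [energy l y b] ([char_weight_at]).  The character is
    bounded below on the orbit iff l is, up to a finite amount, a point of its
    orbit nearest to y; it has minimal energy iff l is a nearest point.  In
    coordinates the seven types of root systems produce moves of only two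
    kinds: b_i, b_j become s b_j + k P, s (b_i - k P) for a sign s (equal to 1
    in type A), and b_i becomes - b_i + k P, where the period P is |c|
    or 2 |c| ([reflection_effect], [weyl_orbit_pair]).  Moves of the first kind
    are all available and change the energy by
      (b_i - s b_j - k P) (y_i - s y_j - k P),
    a product over the two sides of a wall.

    From (2) to (1): let l be nearest to z, with y - z summable.  Given b in
    the orbit, minimise the energy relative to y, up to 1, among the points of
    the orbit that differ from l only on a fixed finite set containing the
    support of b - l.  No pair move improves the near-minimiser b' by much, so
    b' - y and l - z are bounded, up to a common constant in type A.
    Hence b' - l is bounded, and replacing y by z costs at most a constant
    times the sum of the |y_j - z_j| ([energy_bounded_of_summable]).

    From (1) to (2): integrality puts all l_j on a half-integral grid whose
    unit divides the period.  Moves in disjoint pairs have independent effects,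
    so the total gain from exchanges is bounded ([copies_bounded_exchange]).
    Consider all the copies s l_j + k P with companions s y_j + k P.  For each
    grid point n let S(n) be the essential supremum (up to finitely many j) of
    the companions of the copies at or below n, and I(n) the essential infimum
    of the companions of those above n.  If S(n) > I(n), infinitely many
    disjoint exchanges would each gain a fixed amount.  So S <= I, and the
    midpoint theta of S and I is a system of thresholds: the total amount by
    which the companions overstep it is finite, since either only finitely
    many overstep, or each one can be exchanged with a fresh partner arbitrarily
    close to the threshold on the other side ([thresholds_exist]).  Clamping
    y_j between the thresholds adjacent to l_j gives z with y - z summable.

    That l is nearest to z follows from an invariant.  The function U
    on the grid with increments n + 1/2 - theta(n) inherits from theta the
    period, up to a linear term, and the evenness, so the sum of the U(b_j) is
    an invariant of the moves ([reachable_invariant]); and, since z_j lies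
    between the two thresholds at l_j, the point l_j minimises
    (n - z_j)^2 / 2 - U(n) over the grid ([potential_exists]).  Summing over j
    gives energy >= 0 on the whole orbit ([minimal_point_exists]).

    Finally z has to come from a character of the full algebraic dual, on which
    the eps_j do not span; Zorn's lemma supplies it ([linear_extension]). *)

(** * Configurations, moves and the energy *)

Section Variation.
Variables (R : realType) (J : choiceType) (l : J -> R).

Definition finitely_moved (b : J -> R) : Prop :=
  exists s : seq J, forall j, j \notin s -> b j = l j.

(** Energies, invariants of the moves and the components of the weights of the
    orbit are all sums over j of a function of b_j, normalised to vanish at the
    base point l. *)
Definition total_change (V : zmodType) (U : J -> R -> V) (b : J -> R) : V :=
  \sum_(j \in [set: J]) (U j (b j) - U j (l j)).

Lemma fsum_seq (V : nmodType) (F : J -> V) (s : seq J) :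
  uniq s -> (forall j, j \notin s -> F j = 0) ->
  \sum_(j \in [set: J]) F j = \sum_(j <- s) F j.
Proof.
move=> us Fs; rewrite (@bigfs _ _ _ _ s predT F us) //; last by move=> j _ /Fs.
by apply: eq_fsbigl; apply/seteqP; split.
Qed.

Lemma total_changeE (V : zmodType) (U : J -> R -> V) (b : J -> R) (s : seq J) :
  uniq s -> (forall j, j \notin s -> b j = l j) ->
  total_change U b = \sum_(j <- s) (U j (b j) - U j (l j)).
Proof. by move=> us bs; apply: fsum_seq => // j /bs ->; rewrite subrr. Qed.

(** Sums of increments over the two finite sets that occur agree because both
    compute the sum over all of J. *)
Lemma total_change_change (V : zmodType) (U : J -> R -> V) (b b' : J -> R)
    (t : seq J) :
  finitely_moved b -> uniq t -> (forall j, j \notin t -> b' j = b j) ->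
  total_change U b' =
  total_change U b + \sum_(j <- t) (U j (b' j) - U j (b j)).
Proof.
move=> [s bs] ut b't; pose r := undup (s ++ t).
have ur : uniq r by apply: undup_uniq.
rewrite -(@fsum_seq _ (fun j => U j (b' j) - U j (b j)) t)//; last first.
  by move=> j /b't ->; rewrite subrr.
rewrite (@fsum_seq _ _ r)//; last first.
  by move=> j; rewrite mem_undup mem_cat negb_or => /andP[_ /b't ->]; rewrite subrr.
rewrite !(@total_changeE _ _ _ r)//; first last.
- by move=> j; rewrite mem_undup mem_cat negb_or => /andP[js /b't ->]; exact: bs.
- by move=> j; rewrite mem_undup mem_cat negb_or => /andP[js _]; exact: bs.
by rewrite -big_split; apply: eq_bigr => j _ /=; rewrite addrC addrA subrK.
Qed.

End Variation.

Section Moves.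
Variables (R : realType) (J : choiceType) (L : R).

(** The affine reflection in the wall b_i = (-1)^s b_j + k L. *)
Definition pair_move (i j : J) (s : bool) (k : int) (b : J -> R) : J -> R :=
  fun x => if x == i then (-1) ^+ s * b j + k%:~R * L
           else if x == j then (-1) ^+ s * (b i - k%:~R * L) else b x.

Definition sign_move (i : J) (k : int) (b : J -> R) : J -> R :=
  fun x => if x == i then - b i + k%:~R * L else b x.

Lemma pair_moveC i j s k b x : x \notin [:: i; j] -> pair_move i j s k b x = b x.
Proof. by rewrite !inE negb_or /pair_move => /andP[/negbTE -> /negbTE ->]. Qed.

Lemma sign_moveC i k b x : x \notin [:: i] -> sign_move i k b x = b x.
Proof. by rewrite !inE /sign_move => /negbTE ->. Qed.

Lemma pair_move_moved l i j s k b :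
  finitely_moved l b -> finitely_moved l (pair_move i j s k b).
Proof.
case=> r br; exists ([:: i; j] ++ r) => x; rewrite mem_cat negb_or.
by case/andP => xij /br <-; exact: pair_moveC.
Qed.

Lemma sign_move_moved l i k b :
  finitely_moved l b -> finitely_moved l (sign_move i k b).
Proof.
case=> r br; exists ([:: i] ++ r) => x; rewrite mem_cat negb_or.
by case/andP => xij /br <-; exact: sign_moveC.
Qed.

Lemma total_change_pair (V : zmodType) (U : J -> R -> V) l b i j s k :
  finitely_moved l b -> i != j ->
  total_change l U (pair_move i j s k b) = total_change l U b
    + (U i ((-1) ^+ s * b j + k%:~R * L) - U i (b i)
       + (U j ((-1) ^+ s * (b i - k%:~R * L)) - U j (b j))).
Proof.
move=> lb ij; rewrite (@total_change_change _ _ _ _ _ b _ [:: i; j])//; first last.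
- by move=> x; exact: pair_moveC.
- by rewrite /= inE ij.
rewrite !big_cons big_nil addr0 /pair_move eqxx.
by rewrite eq_sym (negbTE ij) eqxx.
Qed.

Lemma total_change_sign (V : zmodType) (U : J -> R -> V) l b i k :
  finitely_moved l b ->
  total_change l U (sign_move i k b) = total_change l U b
    + (U i (- b i + k%:~R * L) - U i (b i)).
Proof.
move=> lb; rewrite (@total_change_change _ _ _ _ _ b _ [:: i])//; last first.
  by move=> x; exact: sign_moveC.
by rewrite big_seq1 /sign_move eqxx.
Qed.

Definition energy (l y b : J -> R) : R :=
  total_change l (fun j x => (x - y j) ^+ 2 / 2) b.

(** The gain formula: a pair move lowers the energy exactly when its wall
    strictly separates b from the centre y. *)
Lemma energy_pair l y b i j s k : finitely_moved l b -> i != j ->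
  energy l y (pair_move i j s k b) = energy l y b
    + (b i - (-1) ^+ s * b j - k%:~R * L) * (y i - (-1) ^+ s * y j - k%:~R * L).
Proof.
move=> lb ij; rewrite /energy total_change_pair//; congr (_ + _).
by case: s => /=; field.
Qed.

Lemma energy_sub l y z b r : uniq r -> (forall j, j \notin r -> b j = l j) ->
  energy l y b = energy l z b + \sum_(j <- r) (b j - l j) * (z j - y j).
Proof.
move=> ur br; rewrite /energy !(@total_changeE _ _ _ _ _ _ r)// -big_split.
by apply: eq_bigr => j _ /=; field.
Qed.

(** The flag sg tells whether sign changes are available.  The points obtained
    here may exceed the Weyl orbit (all sign moves are allowed), which does no
    harm: lower bounds will be proved for all of them. *)
Inductive reachable (sg : bool) (l : J -> R) : (J -> R) -> Prop :=
| reach_start : reachable sg l l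
| reach_pair i j s k b of i != j & (s ==> sg) & reachable sg l b :
    reachable sg l (pair_move i j s k b)
| reach_sign i k b of sg & reachable sg l b :
    reachable sg l (sign_move i k b).

Lemma reachable_moved sg l b : reachable sg l b -> finitely_moved l b.
Proof.
elim=> {b} [|i j s k b _ _ _|i k b _ _]; first by exists [::].
  exact: pair_move_moved.
exact: sign_move_moved.
Qed.

(** A pair move shifts one coordinate by k L and the other by - k L, so the
    increments k tau cancel; this is why quasi-periodicity of U suffices when
    there are no sign changes.  The set P will be the grid of possible
    coordinates, outside which the potential has no meaning. *)
Lemma reachable_invariant (sg : bool) (l : J -> R) (P : R -> Prop)
    (U : R -> R) (tau : R) b :
  (forall x k, P x -> P (x + k%:~R * L)) ->
  (sg -> forall x, P x -> P (- x)) ->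
  (forall x k, P x -> U (x + k%:~R * L) = U x + k%:~R * tau) ->
  (sg -> tau = 0 /\ forall x, P x -> U (- x) = U x) ->
  (forall j, P (l j)) ->
  reachable sg l b ->
  (forall j, P (b j)) /\ total_change l (fun=> U) b = 0.
Proof.
move=> PL PN UL UN Pl; elim=> {b} [|i j s k b ij ssg rb [Pb vb]|i k b hsg rb [Pb vb]].
- split=> //; rewrite (@total_changeE _ _ _ _ _ _ [::])// big_nil//.
- have PS (t : bool) x : t ==> sg -> P x -> P ((-1) ^+ t * x).
    case: t => /= [/PN|_] h; first by rewrite mulN1r => /h.
    by rewrite mul1r.
  have US x : P x -> U ((-1) ^+ s * x) = U x.
    move: ssg; case: s => /= [/UN[_]|_] h; first by rewrite mulN1r => /h.
    by rewrite mul1r.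
  have E x : x - k%:~R * L = x + (- k)%:~R * L by rewrite mulrNz mulNr.
  split.
    move=> x; rewrite /pair_move; case: eqP => _; last case: eqP => _ //.
      by apply: PL; exact: PS.
    by apply: PS => //; rewrite E; exact: PL.
  rewrite total_change_pair ?vb ?add0r; [|exact: reachable_moved rb|by []].
  rewrite UL; last exact: PS.
  rewrite US; last exact: Pb.
  rewrite US E; last exact: PL.
  by rewrite UL// mulrNz mulNr; ring.
- have [tau0 UE] := UN hsg.
  split.
    move=> x; rewrite /sign_move; case: eqP => _ //.
    by apply: PL; exact: PN.
  rewrite total_change_sign ?vb; last exact: reachable_moved rb.
  rewrite UL; last exact: PN.
  by rewrite UE// tau0; ring.
Qed.

End Moves.

(** * Summable changes of the centre keep the energy bounded *)

Lemma infinite_fresh (J : choiceType) (A : set J) (r : seq J) :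
  infinite_set A -> exists2 j, A j & j \notin r.
Proof.
move=> Ai; apply: contrapT => H; apply: Ai.
apply: (@sub_finite_set _ _ [set` r]); last exact: finite_seq.
by move=> j Aj /=; apply: contrapT => /negP jr; apply: H; exists j.
Qed.

Section Gap.
Variable R : realType.

(** If A and B were far apart, some multiple of K would lie deep between them
    and make the product very negative. *)
Lemma pair_gap (K C A B : R) : 0 < K -> 0 <= C ->
  (forall k : int, - C <= (A - k%:~R * K) * (B - k%:~R * K)) ->
  `|A - B| <= 2 * (K + C + 1).
Proof.
move=> K0 C0.
wlog AB : A B / A <= B.
  move=> H; case: (leP A B) => [AB|/ltW BA] h; first exact: H.
  by rewrite distrC; apply: H => // k; rewrite mulrC.
move=> H; rewrite leNgt; apply/negP; rewrite ler0_norm ?subr_le0// => gap.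
pose M := (A + B) / 2; pose k := Num.floor (M / K).
have kM : k%:~R * K <= M by rewrite -ler_pdivlMr// floor_le.
have Mk : M < k%:~R * K + K.
  by rewrite -[X in _ + X]mul1r -mulrDl -ltr_pdivrMr// -[1]/(1%:~R) -intrD floorD1_gt.
have := H k; rewrite /M in kM Mk.
set q := k%:~R * K in kM Mk *.
have : A - q < - (C + 1) by lra.
have : C + 1 < B - q by lra.
nra.
Qed.

End Gap.

Section Lower.
Variables (R : realType) (J : choiceType) (sg : bool) (L : R) (l : J -> R).
Variable O : (J -> R) -> Prop.
Hypothesis J_infinite : infinite_set [set: J].
Hypothesis L_gt0 : 0 < L.
Hypothesis O_start : O l.
Hypothesis O_moved : forall b, O b -> finitely_moved l b.
Hypothesis O_pair : forall i j s k b,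
  i != j -> s ==> sg -> O b -> O (pair_move L i j s k b).
Hypothesis O_sum : ~~ sg -> forall b, O b -> total_change l (fun=> id) b = 0.

Lemma energy_ge_support y b r : uniq r -> (forall j, j \notin r -> b j = l j) ->
  - (\sum_(j <- r) (l j - y j) ^+ 2 / 2) <= energy l y b.
Proof.
move=> ur br; rewrite /energy (total_changeE _ ur br) -sumrN; apply: ler_sum => j _ /=.
by have := sqr_ge0 (b j - y j); lra.
Qed.

(** A near-minimiser is aligned with the centre: applied to the two signs s it
    bounds b - y, and with s = false alone it bounds b - y up to a common
    constant. *)
Lemma pair_deviation y b (C : R) i j s : O b -> i != j -> s ==> sg -> 0 <= C ->
  (forall k, energy l y b - C <= energy l y (pair_move L i j s k b)) ->
  `|(b i - y i) - (-1) ^+ s * (b j - y j)| <= 2 * (L + C + 1).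
Proof.
move=> Ob ij ssg C0 H.
have -> : (b i - y i) - (-1) ^+ s * (b j - y j) =
  (b i - (-1) ^+ s * b j) - (y i - (-1) ^+ s * y j) by ring.
apply: pair_gap => // k.
by have := H k; rewrite energy_pair//; [lra|exact: O_moved].
Qed.

(** With sign changes, the sum and the difference of two coordinates are
    bounded, hence so is each.  Without them only differences are controlled,
    but the displacements add up to 0, and a number is at most the largest
    distance to the members of a family with average 0. *)
Lemma deviation_bound (B : R) b r : O b -> uniq r ->
  (forall j, j \notin r -> b j = l j) -> (1 < size r)%N ->
  (forall i j s, i \in r -> j \in r -> i != j -> s ==> sg ->
     `|(b i - l i) - (-1) ^+ s * (b j - l j)| <= B) ->
  forall i, i \in r -> `|b i - l i| <= B.
Proof.
move=> Ob ur br r1 H i ir.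
have [j jr ij] : exists2 j, j \in r & i != j.
  case: r {H br} ur r1 ir => [|x [|x' r]] //= /andP[xr _] _ _.
  have xx' : x != x' by apply: contra xr => /eqP ->; rewrite inE eqxx.
  case: (eqVneq i x) => [->|ix]; first by exists x'; rewrite // !inE eqxx orbT.
  by exists x; rewrite // inE eqxx.
have [hsg|/O_sum/(_ _ Ob)] := boolP sg.
  have := H i j true ir jr ij hsg; rewrite expr1.
  have := H i j false ir jr ij isT; rewrite expr0.
  rewrite !ler_norml; lra.
rewrite (total_changeE _ ur br) => sum0.
have B0 : 0 <= B by apply: le_trans (H i j false ir jr ij isT); exact: normr_ge0.
have E : (b i - l i) * (size r)%:R = \sum_(x <- r) ((b i - l i) - (b x - l x)).
  by rewrite mulr_natr sumrB sum0 subr0 big_const_seq count_predT iter_addr_0.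
have n0 : 0 < (size r)%:R :> R by rewrite ltr0n; case: (size r) r1.
rewrite -(ler_pM2r n0) -[X in _ * X]ger0_norm ?ler0n// -normrM E.
apply: le_trans (ler_norm_sum _ _ _) _.
rewrite mulr_natr -iter_addr_0 -(count_predT r) -big_const_seq.
rewrite big_seq [leRHS]big_seq; apply: ler_sum => x xr.
case: (eqVneq i x) => [->|ix]; first by rewrite subrr normr0.
by have := H i x false ir xr ix isT; rewrite expr0 mul1r.
Qed.

(** A configuration whose energy relative to y is within 1 of the infimum on a
    fixed finite support is aligned with y, hence close to l; there the
    energies relative to y and z differ by a bounded amount. *)
Theorem energy_bounded_of_summable y z (S : R) :
  (forall b, O b -> 0 <= energy l z b) ->
  (forall r, uniq r -> \sum_(j <- r) `|z j - y j| <= S) ->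
  exists C, forall b, O b -> - C <= energy l y b.
Proof.
(* 1 is the slack of the near-minimiser b below, and 4 (L + 2) + 2 S bounds
   the displacement of each of its coordinates. *)
move=> z0 zy; exists (1 + (4 * (L + 2) + 2 * S) * S) => b0 Ob0.
have S0 : 0 <= S by have := zy [::] isT; rewrite big_nil.
have dS j : `|z j - y j| <= S by have := zy [:: j] isT; rewrite big_seq1.
have [r0 b0r] := O_moved Ob0.
have [x0 _ _] := infinite_fresh [::] J_infinite.
have [x1 _ x10] := infinite_fresh [:: x0] J_infinite.
have x01 : x0 != x1 by move: x10; rewrite inE eq_sym.
pose r := undup ([:: x0; x1] ++ r0).
have ur : uniq r by exact: undup_uniq.
have r1 : (1 < size r)%N.
  have : {subset [:: x0; x1] <= r}.
    by move=> x xx; rewrite mem_undup mem_cat xx.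
  by move/uniq_leq_size; apply; rewrite /= inE x01.
pose P b := O b /\ forall j, j \notin r -> b j = l j.
have Pb0 : P b0.
  by split=> // j; rewrite mem_undup mem_cat negb_or => /andP[_ /b0r].
pose A := [set energy l y b | b in [set b | P b]].
have infA : has_inf A.
  split; first by exists (energy l y b0), b0.
  exists (- (\sum_(j <- r) (l j - y j) ^+ 2 / 2)) => _ [b [Ob br] <-].
  exact: energy_ge_support.
have [_ [b [Ob br] <-] bE] := inf_adherent (ltr01 : 0 < 1 :> R) infA.
have min b' : P b' -> energy l y b - 1 <= energy l y b'.
  move=> Pb'; have : inf A <= energy l y b' by apply: ge_inf; [case: infA|exists b'].
  by lra.
have dev i : i \in r -> `|b i - l i| <= 4 * (L + 2) + 2 * S.
  apply: deviation_bound => // {}i j s ir jr ij ssg.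
  have h1 : `|(b i - y i) - (-1) ^+ s * (b j - y j)| <= 2 * (L + 1 + 1).
    apply: pair_deviation => // k; apply: min; split; first exact: O_pair.
    move=> x xr; rewrite pair_moveC ?br// !inE negb_or.
    by apply/andP; split; apply: contraNneq xr => ->.
  have h2 : `|(l i - z i) - (-1) ^+ s * (l j - z j)| <= 2 * (L + 0 + 1).
    apply: pair_deviation => // k.
    rewrite /energy (@total_changeE _ _ _ _ _ l [::])// big_nil subr0.
    by apply: z0; exact: O_pair.
  have h3 := dS i; have h4 := dS j.
  move: h1 h2 h3 h4; rewrite !ler_norml.
  by case: s {ssg}; rewrite ?expr0 ?expr1; lra.
apply: le_trans (min _ Pb0).
rewrite (energy_sub y z ur br).
have : - ((4 * (L + 2) + 2 * S) * S) <= \sum_(j <- r) (b j - l j) * (z j - y j).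
  rewrite lerNl -sumrN; apply: (@le_trans _ _ (\sum_(j <- r) (4 * (L + 2) + 2 * S) * `|z j - y j|)).
    rewrite big_seq [leRHS]big_seq; apply: ler_sum => j jr.
    apply: le_trans (ler_norm _) _; rewrite normrN normrM.
    by apply: ler_wpM2r => //; exact: dev.
  rewrite -mulr_sumr; apply: ler_wpM2l; last exact: zy.
  by have := ltW L_gt0; lra.
by have := z0 _ Ob; lra.
Qed.

End Lower.

(** * Levels, heights and exchanges of pairs *)

Section Levels.
Variables (R : realType) (J : choiceType) (sg : bool) (K : int).
Hypothesis J_infinite : infinite_set [set: J].
Hypothesis K_gt0 : 0 < K.

(** The index (j, s, k) stands for the image of the coordinate j under
    x |-> (-1)^s x + k K. *)
Definition affine_copy := (J * bool * int)%type.
Definition index_of (t : affine_copy) : J := t.1.1.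
Definition admissible (t : affine_copy) : bool := t.1.2 ==> sg.
Definition level (m : J -> int) (t : affine_copy) : int :=
  (-1) ^+ t.1.2 * m t.1.1 + t.2 * K.
Definition height (Y : J -> R) (t : affine_copy) : R :=
  (-1) ^+ t.1.2 * Y t.1.1 + t.2%:~R * K%:~R.

(** Exchanging the two members of a pair of copies changes the energy by the
    corresponding summand; as the indices are distinct, all the exchanges of
    the list can be performed together. *)
Definition bounded_exchange (C : R) (m : J -> int) (Y : J -> R) : Prop :=
  forall ps : seq (affine_copy * affine_copy),
    uniq ([seq index_of p.1 | p <- ps] ++ [seq index_of p.2 | p <- ps]) ->
    all (fun p => admissible p.1 && admissible p.2) ps ->
    - C <= \sum_(p <- ps)
      (level m p.1 - level m p.2)%:~R * (height Y p.1 - height Y p.2).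

(** The copies that would gain from an exchange across level n with a partner
    on the other side of the height tau; [high] and [low] record only their
    indices, since fresh partners need fresh indices. *)
Definition high_copies m Y (n : int) (tau : R) : set affine_copy :=
  [set t | [/\ admissible t, level m t <= n & tau < height Y t]].
Definition low_copies m Y (n : int) (tau : R) : set affine_copy :=
  [set t | [/\ admissible t, n < level m t & height Y t < tau]].
Definition high m Y n tau : set J := index_of @` high_copies m Y n tau.
Definition low m Y n tau : set J := index_of @` low_copies m Y n tau.

(** The essential supremum of the heights at levels at most n: a height is
    disregarded if only finitely many indices exceed it. *)
Definition sup_below m Y (n : int) : R :=
  inf [set tau | finite_set (high m Y n tau)].
(** The negative of the essential supremum for the opposite data: the levels
    greater than n become those at most - n - 1.  Defining it this way leaves
    only one of the two cases to be proved in what follows. *)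
Definition inf_above m Y (n : int) : R :=
  - sup_below (fun j => - m j) (fun j => - Y j) (- n - 1).
Definition threshold m Y (n : int) : R :=
  (sup_below m Y n + inf_above m Y n) / 2.

Definition opp_copy (t : affine_copy) : affine_copy := (t.1, - t.2).
Definition shift_copy (q : int) (t : affine_copy) : affine_copy := (t.1, t.2 + q).

Lemma level_opp m t : level (fun j => - m j) (opp_copy t) = - level m t.
Proof. by rewrite /level /=; ring. Qed.

Lemma height_opp Y t : height (fun j => - Y j) (opp_copy t) = - height Y t.
Proof. by rewrite /height /= mulrNz; ring. Qed.

Lemma level_shift m q t : level m (shift_copy q t) = level m t + q * K.
Proof. by rewrite /level /=; ring. Qed.

Lemma height_shift Y q t :
  height Y (shift_copy q t) = height Y t + q%:~R * K%:~R.
Proof. by rewrite /height /= intrD; ring. Qed.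

Lemma opp_copyK : involutive opp_copy.
Proof. by move=> [t k]; rewrite /opp_copy /= opprK. Qed.

Lemma low_opp m Y n tau :
  low m Y n tau = high (fun j => - m j) (fun j => - Y j) (- n - 1) (- tau).
Proof.
clear K_gt0; apply/seteqP; split=> j [t [ta tn tt] <-].
  exists (opp_copy t) => //; split=> //; rewrite ?level_opp ?height_opp ?ltrN2//.
  by move: tn; set x := level m t; lia.
exists (opp_copy t) => //; rewrite -(opp_copyK t) in tn tt.
rewrite level_opp in tn; rewrite height_opp ltrN2 in tt; split=> //.
by move: tn; set x := level m _; lia.
Qed.

Lemma bounded_exchange_opp C m Y : bounded_exchange C m Y ->
  bounded_exchange C (fun j => - m j) (fun j => - Y j).
Proof.
move=> H ps ups aps.
have := H [seq (opp_copy p.1, opp_copy p.2) | p <- ps].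
rewrite -!map_comp all_map => /(_ ups aps) /le_trans; apply.
rewrite big_map le_eqVlt; apply/orP; left; apply/eqP; apply: eq_bigr => p _ /=.
have lE t : level (fun j => - m j) t = - level m (opp_copy t).
  by rewrite -level_opp opp_copyK.
have hE t : height (fun j => - Y j) t = - height Y (opp_copy t).
  by rewrite -height_opp opp_copyK.
by rewrite !lE !hE -opprD intrN -opprD mulrNN.
Qed.

Lemma bounded_exchange_ge0 C m Y : bounded_exchange C m Y -> 0 <= C.
Proof. by move=> /(_ [::] isT isT); rewrite big_nil oppr_le0. Qed.

(** Differences of two indices are controlled by [pair_gap], so comparison with
    a single index j0 bounds all of them. *)
Lemma level_height_near C m Y : bounded_exchange C m Y ->
  exists B : R, forall t, `|(level m t)%:~R - height Y t| <= B.
Proof.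
move=> H; have C0 := bounded_exchange_ge0 H.
have [j0 _ _] := infinite_fresh [::] J_infinite.
pose d j := (m j)%:~R - Y j.
exists (`|d j0| + 2 * (K%:~R + C + 1)) => t.
have -> : `|(level m t)%:~R - height Y t| = `|d t.1.1|.
  rewrite /level /height intrD !intrM opprD addrACA subrr addr0.
  rewrite intr_sign -mulrBr normrM normrX normrN1 expr1n mul1r//.
set j := t.1.1; have K0 : 0 < K%:~R :> R by rewrite ltr0z.
have [->|jj0] := eqVneq j j0; first by rewrite lerDl; lra.
have : `|((m j)%:~R - (m j0)%:~R) - (Y j - Y j0)| <= 2 * (K%:~R + C + 1).
  apply: pair_gap => // k.
  have := H [:: ((j, false, 0), (j0, false, k))]; rewrite /= andbT inE.
  move=> /(_ jj0 isT); rewrite big_seq1 /level /height /= !expr0 !mul1r.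
  rewrite !intrD !intrN !intrM; lra.
have -> : (m j)%:~R - (m j0)%:~R - (Y j - Y j0) = d j - d j0 by rewrite /d; ring.
by have := lerB_dist (d j) (d j0); lra.
Qed.

Lemma disjoint_copies (A : set affine_copy) (r : seq J) (N : nat) :
  infinite_set (index_of @` A) -> uniq r ->
  exists ts, [/\ size ts = N, forall t, t \in ts -> A t &
                 uniq (r ++ [seq index_of t | t <- ts])].
Proof.
move=> Ai ur; elim: N => [|N [ts [ts1 ts2 ts3]]].
  by exists [::]; split=> //; rewrite cats0.
have [_ [t At <-] tr] := infinite_fresh (r ++ [seq index_of t | t <- ts]) Ai.
exists (t :: ts); split=> /=; first by rewrite ts1.
  by move=> t'; rewrite inE => /orP[/eqP ->//|/ts2].
by rewrite -cat1s uniq_catCA /= tr.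
Qed.

(** Pair each of the given copies with its own partner of higher level and of
    height below tau: the exchange gains at least the excess over tau, the two
    integral levels differing by at least 1. *)
Lemma excess_le C m Y n tau ts : bounded_exchange C m Y ->
  infinite_set (low m Y n tau) -> uniq [seq index_of t | t <- ts] ->
  (forall t, t \in ts -> high_copies m Y n tau t) ->
  \sum_(t <- ts) (height Y t - tau) <= C.
Proof.
clear J_infinite K_gt0; move=> H lowi uts hts.
have [us [sus lus uus]] := disjoint_copies (size ts) lowi uts.
have z1 : [seq index_of p.1 | p <- zip ts us] = [seq index_of t | t <- ts].
  by rewrite -{2}(@unzip1_zip _ _ ts us) ?sus// -map_comp.
have z2 : [seq index_of p.2 | p <- zip ts us] = [seq index_of t | t <- us].
  by rewrite -{2}(@unzip2_zip _ _ ts us) ?sus// -map_comp.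
have := H (zip ts us); rewrite z1 z2.
have mem p : p \in zip ts us -> high_copies m Y n tau p.1 /\ low_copies m Y n tau p.2.
  move=> ptu; split.
    by apply: hts; rewrite -(@unzip1_zip _ _ ts us) ?sus//; exact: map_f.
  by apply: lus; rewrite -(@unzip2_zip _ _ ts us) ?sus//; exact: map_f.
move=> /(_ uus); have -> : all (fun p => admissible p.1 && admissible p.2) (zip ts us).
  by apply/allP => p /mem[[-> _ _] [-> _ _]].
move=> /(_ isT); rewrite lerNl => /(le_trans _); apply.
have -> : \sum_(t <- ts) (height Y t - tau) =
          \sum_(p <- zip ts us) (height Y p.1 - tau).
  by rewrite -{1}(@unzip1_zip _ _ ts us) ?sus// big_map.
rewrite -sumrN big_seq [leRHS]big_seq; apply: ler_sum => p /mem[].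
move=> [_ p1 h1] [_ p2 h2].
have : 1 <= (level m p.2 - level m p.1)%:~R :> R by rewrite ler1z; lia.
rewrite -(opprB (level m p.2)) intrN mulNr opprK => ab.
apply: (@le_trans _ _ (1 * (height Y p.1 - height Y p.2))); first by lra.
by apply: ler_wpM2r => //; lra.
Qed.

Section OneSide.
Variables (B : R) (m : J -> int) (Y : J -> R).
Hypothesis near : forall t, `|(level m t)%:~R - height Y t| <= B.

Lemma high_empty n tau : n%:~R + B <= tau -> high m Y n tau = set0.
Proof.
move=> h; rewrite -subset0 => _ [t [_ tn tt] _] /=.
have := near t; rewrite ler_norml => /andP[].
by move: tn; rewrite -(ler_int R); lra.
Qed.

(** Each index has a copy at a level in the window (n - K, n], and its height
    is within B of it. *)
Lemma high_full n tau : tau < n%:~R - K%:~R - B -> high m Y n tau = setT.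
Proof.
move=> h; apply/seteqP; split=> // j _.
pose t : affine_copy := (j, false, ((n - m j) %/ K)%Z).
exists t => //.
have E : level m t = n - ((n - m j) %% K)%Z.
  rewrite /level /= expr0 mul1r.
  by have := divz_eq (n - m j) K; lia.
have r0 : 0 <= ((n - m j) %% K)%Z by apply: modz_ge0; lia.
have rK : ((n - m j) %% K)%Z < K by apply: ltz_pmod.
split=> //; first by rewrite E; lia.
have : n - K < level m t by rewrite E; lia.
rewrite -(ltr_int R) intrD intrN => ?.
by have := near t; rewrite ler_norml => /andP[]; lra.
Qed.

Lemma high_le n n' tau tau' : n <= n' -> tau' <= tau ->
  high m Y n tau `<=` high m Y n' tau'.
Proof.
move=> nn tt _ [t [ta tn th] <-]; exists t => //.
by split=> //; [exact: le_trans tn nn|exact: le_lt_trans tt th].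
Qed.

Lemma has_inf_high n : has_inf [set tau | finite_set (high m Y n tau)].
Proof.
split; first by exists (n%:~R + B) => /=; rewrite high_empty.
exists (n%:~R - K%:~R - B) => tau /= fin; rewrite leNgt; apply/negP => h.
by apply: J_infinite; rewrite -(high_full h).
Qed.

Lemma finite_high n tau : sup_below m Y n < tau -> finite_set (high m Y n tau).
Proof.
move=> h; have [[x xfin] _] := has_inf_high n.
have [tau' fin tt] : exists2 t, finite_set (high m Y n t) & t < tau.
  by have [t ? ?] := inf_lt (ex_intro _ x xfin) h; exists t.
exact: sub_finite_set (high_le (lexx n) (ltW tt)) fin.
Qed.

Lemma infinite_high n tau :
  tau < sup_below m Y n -> infinite_set (high m Y n tau).
Proof.
move=> h fin; have := ge_inf (has_inf_high n).2 fin.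
by rewrite leNgt h.
Qed.

Lemma sup_below_mono n : sup_below m Y n <= sup_below m Y (n + 1).
Proof.
apply: lb_le_inf => [|tau fin]; first exact: (has_inf_high _).1.
apply: (ge_inf (has_inf_high n).2) => /=.
by apply: sub_finite_set fin; apply: high_le => //; lia.
Qed.

Lemma high_shift n tau q :
  high m Y n tau `<=` high m Y (n + q * K) (tau + q%:~R * K%:~R).
Proof.
move=> _ [t [ta tn th] <-]; exists (shift_copy q t) => //.
by split=> //; rewrite ?level_shift ?height_shift ?lerD2r// ltrD2r.
Qed.

Lemma sup_below_shift n q :
  sup_below m Y (n + q * K) = sup_below m Y n + q%:~R * K%:~R.
Proof.
have le_shift n' q' :
    sup_below m Y (n' + q' * K) <= sup_below m Y n' + q'%:~R * K%:~R.
  rewrite -lerBlDr; apply: lb_le_inf => [|tau fin]; first exact: (has_inf_high _).1.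
  rewrite lerBlDr; apply: (ge_inf (has_inf_high _).2) => /=.
  apply: sub_finite_set fin => j /(high_shift (- q')).
  by rewrite mulrNz !mulNr !addrK.
apply/eqP; rewrite eq_le le_shift /=.
have := le_shift (n + q * K) (- q); rewrite mulrNz !mulNr addrK.
by rewrite lerBrDr.
Qed.

End OneSide.

End Levels.

(** * Thresholds between consecutive levels *)

Section Threshold.
Variables (R : realType) (J : choiceType) (sg : bool) (K : int).
Hypothesis J_infinite : infinite_set [set: J].
Hypothesis K_gt0 : 0 < K.

Local Notation negm m := (fun j => - m j).

Section Data.
Variables (C : R) (m : J -> int) (Y : J -> R).
Hypothesis exch : bounded_exchange sg K C m Y.

Lemma near_opp B :
  (forall t, `|(level K m t)%:~R - height K Y t| <= B) ->
  forall t, `|(level K (negm m) t)%:~R - height K (negm Y) t| <= B.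
Proof.
move=> near t; rewrite -(opp_copyK t) level_opp height_opp intrN -opprD normrN.
exact: near.
Qed.

Lemma infinite_low n tau :
  inf_above sg K m Y n < tau -> infinite_set (low sg K m Y n tau).
Proof.
have [B /near_opp near] := level_height_near J_infinite K_gt0 exch.
rewrite low_opp /inf_above ltrNl => h.
exact: (infinite_high J_infinite K_gt0 near).
Qed.

(** Otherwise there are heights lo < hi with infinitely many low copies for lo
    and infinitely many high ones for hi; exchanging sufficiently many pairs
    would gain an arbitrary amount. *)
Lemma sup_below_le_inf_above n :
  sup_below sg K m Y n <= inf_above sg K m Y n.
Proof.
rewrite leNgt; apply/negP => h.
have [B near] := level_height_near J_infinite K_gt0 exch.
pose S := sup_below sg K m Y n; pose I := inf_above sg K m Y n.
pose lo := (2 * I + S) / 3; pose hi := (I + 2 * S) / 3.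
have lowi : infinite_set (low sg K m Y n lo).
  by apply: infinite_low; rewrite -/I -/S in h *; rewrite /lo; lra.
have highi : infinite_set (high sg K m Y n hi).
  apply: (infinite_high J_infinite K_gt0 near).
  by rewrite -/I -/S in h *; rewrite /hi; lra.
have gap : 0 < hi - lo by rewrite -/I -/S in h; rewrite /hi /lo; lra.
have C0 := bounded_exchange_ge0 exch.
pose N := (Num.truncn (C / (hi - lo))).+1.
have [ts [tsN tsh /= uts]] := disjoint_copies N highi (isT : uniq [::]).
have : \sum_(t <- ts) (height K Y t - lo) <= C.
  apply: excess_le exch lowi uts _ => t /tsh[ta tn th].
  by split=> //; lra.
apply/negP; rewrite -ltNge.
apply: (@lt_le_trans _ _ (\sum_(t <- ts) (hi - lo))).
  rewrite big_const_seq count_predT iter_addr_0 tsN -mulr_natl -ltr_pdivrMr//.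
  exact: truncnS_gt.
rewrite big_seq [leRHS]big_seq; apply: ler_sum => t /tsh[_ _ th].
by rewrite lerD2r ltW.
Qed.

(** Either the two essential bounds coincide with the threshold, and partners
    arbitrarily close to it are available for an exchange; or the threshold
    strictly exceeds the essential supremum, and only finitely many indices
    overstep it. *)
Lemma excess_bounded n : exists C' : R, forall ts,
  uniq [seq index_of t | t <- ts] ->
  (forall t, t \in ts -> admissible sg t /\ level K m t = n) ->
  \sum_(t <- ts) Num.max (height K Y t - threshold sg K m Y n) 0 <= C'.
Proof.
have [B near] := level_height_near J_infinite K_gt0 exch.
set S := sup_below sg K m Y n; set I := inf_above sg K m Y n.
have SI : S <= I := sup_below_le_inf_above n.
set th := threshold sg K m Y n; have thE : th = (S + I) / 2 by [].
move: SI; rewrite le_eqVlt => /orP[/eqP SI|SI].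
  exists (C + 1) => ts uts hts.
  have C0 := bounded_exchange_ge0 exch.
  (* The thresholds may not be attained by partners, so each of the at most
     size ts exchanges aims at th + eta; together they lose less than 1. *)
  pose eta := (size ts).+1%:R^-1 : R.
  have eta0 : 0 < eta by rewrite invr_gt0 ltr0n.
  have lowi : infinite_set (low sg K m Y n (th + eta)).
    by apply: infinite_low; rewrite -/I thE; lra.
  pose us := [seq t <- ts | th + eta < height K Y t].
  have le1 : \sum_(t <- us) (height K Y t - (th + eta)) <= C.
    apply: (excess_le exch lowi).
      by apply: subseq_uniq uts; apply: map_subseq; exact: filter_subseq.
    move=> t; rewrite mem_filter => /andP[tt /hts[ta tn]].
    by split=> //; rewrite tn.
  apply: (@le_trans _ _ (\sum_(t <- us) (height K Y t - (th + eta)) +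
                         \sum_(t <- ts) eta)).
    rewrite big_filter [X in _ <= X + _]big_mkcond -big_split; apply: ler_sum => t _ /=.
    by case: ifPn => [|/negbTE]; rewrite ?ltNge => h; rewrite ge_max; apply/andP;
      split; move: h; try move/negbFE; lra.
  apply: lerD => //; rewrite big_const_seq count_predT iter_addr_0 -mulr_natl.
  by rewrite ler_pdivrMr ?ltr0n// mul1r ler_nat.
have fin : finite_set (high sg K m Y n th).
  by apply: (finite_high J_infinite K_gt0 near); rewrite -/S thE; lra.
have [s sE] := (finite_seqP _).1 fin.
pose M := Num.max (n%:~R + B - th) 0.
have M0 : 0 <= M by rewrite le_max lexx orbT.
exists (M * (size s)%:R) => ts uts hts.
pose us := [seq t <- ts | th < height K Y t].
apply: (@le_trans _ _ (\sum_(t <- us) M)).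
  rewrite big_filter [leRHS]big_mkcond big_seq [leRHS]big_seq.
  apply: ler_sum => t /hts[_ tn] /=.
  case: ifPn => [h|]; last by rewrite -leNgt ge_max lexx andbT subr_le0.
  rewrite /M ge_max !le_max lexx orbT andbT; apply/orP; left.
  by have := near t; rewrite tn ler_norml => /andP[]; lra.
rewrite big_const_seq count_predT iter_addr_0 -[leLHS]mulr_natr; apply: ler_wpM2l => //.
rewrite ler_nat -(size_map (@index_of J)); apply: uniq_leq_size.
  by apply: subseq_uniq uts; apply: map_subseq; exact: filter_subseq.
move=> j /mapP[t]; rewrite mem_filter => /andP[tt /hts[ta tn]] ->.
have : high sg K m Y n th (index_of t) by exists t => //; split=> //; rewrite tn.
by rewrite sE.
Qed.

Lemma threshold_mono n : threshold sg K m Y n <= threshold sg K m Y (n + 1).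
Proof.
have [B near] := level_height_near J_infinite K_gt0 exch.
have := sup_below_mono sg J_infinite K_gt0 near n.
have := sup_below_mono sg J_infinite K_gt0 (near_opp near) (- (n + 1) - 1).
rewrite /threshold /inf_above.
have -> : - (n + 1) - 1 + 1 = - n - 1 :> int by lia.
by lra.
Qed.

Lemma threshold_shift n q :
  threshold sg K m Y (n + q * K) = threshold sg K m Y n + q%:~R * K%:~R.
Proof.
have [B near] := level_height_near J_infinite K_gt0 exch.
rewrite /threshold /inf_above (sup_below_shift sg J_infinite K_gt0 near).
have -> : - (n + q * K) - 1 = - n - 1 + - q * K by lia.
rewrite (sup_below_shift sg J_infinite K_gt0 (near_opp near)) mulrNz.
by field.
Qed.

Lemma threshold_opp n :
  threshold sg K (negm m) (negm Y) n = - threshold sg K m Y (- n - 1).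
Proof.
rewrite /threshold /inf_above.
have -> : - (- n - 1) - 1 = n by lia.
have -> : (fun j => - - m j) = m by apply/funext => j; rewrite opprK.
have -> : (fun j => - - Y j) = Y by apply/funext => j; rewrite opprK.
by field.
Qed.

(** With sign changes the opposite of a copy is a copy of the same index; the
    midpoint of the two essential bounds is the choice that respects this
    symmetry. *)
Lemma threshold_odd n : sg ->
  threshold sg K m Y (- n - 1) = - threshold sg K m Y n.
Proof.
move=> hsg; rewrite -[LHS]opprK -threshold_opp; congr (- _).
have E n' tau : high sg K (negm m) (negm Y) n' tau = high sg K m Y n' tau.
  apply/seteqP; split=> j [[[j' s] k] [ta tn th] <-];
    exists (j', ~~ s, k) => //; (split; [by rewrite /admissible hsg implybT|..]);
    move: tn th; rewrite /level /height /=; case: s {ta} => /=;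
    rewrite ?expr0 ?expr1 ?mul1r ?mulN1r ?opprK//.
have SE n' : sup_below sg K (negm m) (negm Y) n' = sup_below sg K m Y n'.
  by rewrite /sup_below; congr inf; apply/funext => tau; rewrite /= E.
rewrite /threshold /inf_above.
have -> : (fun j => - - m j) = m by apply/funext => j; rewrite opprK.
have -> : (fun j => - - Y j) = Y by apply/funext => j; rewrite opprK.
by rewrite !SE.
Qed.

(** Levels matter only modulo K, so finitely many of the bounds of
    [excess_bounded] are involved. *)
Lemma excess_total : exists C' : R, forall r, uniq r ->
  \sum_(j <- r) Num.max (Y j - threshold sg K m Y (m j)) 0 <= C'.
Proof.
have [c cE] := choice excess_bounded.
have [k KE] : exists k, K = k.+1%:Z by case: (K) K_gt0 => [[|k]|k]//; exists k.
exists (\sum_(i < k.+1) c i%:Z) => r ur.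
pose tl (j : J) : affine_copy J := (j, false, - (m j %/ K)%Z).
have lev j : level K m (tl j) = (m j %% K)%Z.
  by rewrite /level /= expr0; have := divz_eq (m j) K; lia.
have hei j : Y j - threshold sg K m Y (m j) =
             height K Y (tl j) - threshold sg K m Y (level K m (tl j)).
  have -> : threshold sg K m Y (m j) =
            threshold sg K m Y (m j %% K)%Z + (m j %/ K)%Z%:~R * K%:~R.
    by rewrite -threshold_shift; congr threshold; rewrite addrC -divz_eq.
  by rewrite lev /height /= expr0 mulrNz; ring.
pose p j : 'I_k.+1 := inord `|(m j %% K)%Z|%N.
have pE j : level K m (tl j) = (p j)%:Z.
  have r0 : 0 <= (m j %% K)%Z by apply: modz_ge0; lia.
  have rK : (m j %% K)%Z < K by apply: ltz_pmod.
  by rewrite lev /p inordK; lia.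
rewrite (partition_big p xpredT)//=; apply: ler_sum => i _.
have := cE i%:Z [seq tl j | j <- r & p j == i].
rewrite -map_comp map_id_in// filter_uniq// => /(_ isT); rewrite big_map big_filter.
have h t : t \in [seq tl j | j <- r & p j == i] ->
    admissible sg t /\ level K m t = i%:Z.
  case/mapP => j; rewrite mem_filter => /andP[/eqP pj _] ->.
  by split=> //; rewrite pE pj.
move=> /(_ h); apply: le_trans; rewrite le_eqVlt; apply/orP; left; apply/eqP.
by apply: eq_bigr => j /eqP pj; rewrite hei pE pj.
Qed.

End Data.

Theorem thresholds_exist (C : R) (m : J -> int) (Y : J -> R) :
  bounded_exchange sg K C m Y ->
  exists (theta : int -> R) (C' : R),
  [/\ forall n, theta n <= theta (n + 1),
      forall n, theta (n + K) = theta n + K%:~R,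
      sg -> forall n, theta (- n - 1) = - theta n &
      forall r, uniq r -> \sum_(j <- r) (Num.max (Y j - theta (m j)) 0 +
                  Num.max (theta (m j - 1) - Y j) 0) <= C'].
Proof.
move=> exch; exists (threshold sg K m Y).
have [C1 C1E] := excess_total exch.
have [C2 C2E] := excess_total (bounded_exchange_opp exch).
exists (C1 + C2); split.
- exact: threshold_mono exch.
- by move=> n; have := threshold_shift exch n 1; rewrite !mul1r.
- by move=> hsg n; exact: threshold_odd.
- move=> r ur; rewrite big_split; apply: lerD; first exact: C1E.
  apply: le_trans (C2E r ur); rewrite le_eqVlt; apply/orP; left; apply/eqP.
  apply: eq_bigr => j _; congr (Num.max _ _).
  by rewrite (threshold_opp m Y (- m j)) !opprK addrC.
Qed.

End Threshold.

(** * An invariant potential *)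

Section Potential.
Variable R : realType.

Lemma int_primitive (h : int -> R) :
  exists U : int -> R, forall n, U (n + 1) = U n + h n.
Proof.
exists (fun n => match n with
  | Posz n => \sum_(i < n) h i%:Z
  | Negz n => - \sum_(i < n.+1) h (Negz i) end).
case=> n.
  have -> : Posz n + 1 = Posz n.+1 by lia.
  by rewrite big_ord_recr.
case: n => [|n].
  have -> : Negz 0 + 1 = Posz 0 by [].
  by rewrite big_ord_recr !big_ord0 /= add0r addNr.
have -> : Negz n.+1 + 1 = Negz n by rewrite !NegzE; lia.
by rewrite [in RHS]big_ord_recr /= opprD subrK.
Qed.

Lemma int_stationary (g : int -> R) (n : int) :
  (forall n, g (n + 1) = g n) -> g n = g 0.
Proof.
move=> gS; elim/int_rec: n => // [n <-|n <-]; rewrite -gS.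
  by rewrite gS -[RHS]gS; congr g; lia.
by congr g; lia.
Qed.

Lemma int_unimodal (g : int -> R) (m n : int) :
  (forall n, m <= n -> g n <= g (n + 1)) ->
  (forall n, n < m -> g (n + 1) <= g n) -> g m <= g n.
Proof.
move=> up down; have [mn|nm] := leP m n.
  have -> : n = m + `|n - m|%N%:Z by lia.
  elim: `|n - m|%N => [|k IH]; first by rewrite addr0.
  apply: le_trans IH _; have := up (m + k%:Z) ltac:(lia).
  by have -> : m + k%:Z + 1 = m + k.+1%:Z by lia.
have -> : n = m - `|n - m|%N%:Z by lia.
elim: `|n - m|%N => [|k IH]; first by rewrite subr0.
apply: le_trans IH _; have := down (m - k.+1%:Z) ltac:(lia).
by have -> : m - k.+1%:Z + 1 = m - k%:Z by lia.
Qed.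

(** U has the increments n + 1/2 - theta n.  Then (n - z)^2 / 2 - U n has the
    increments theta n - z, which change sign at the levels m whose adjacent
    thresholds enclose z; and periodicity and oddness of theta become
    quasi-periodicity and evenness of U. *)
Lemma potential_exists (sg : bool) (K : int) (theta : int -> R) :
  (forall n, theta n <= theta (n + 1)) ->
  (forall n, theta (n + K) = theta n + K%:~R) ->
  (sg -> forall n, theta (- n - 1) = - theta n) ->
  exists (U : int -> R) (tau : R),
  [/\ forall n q, U (n + q * K) = U n + q%:~R * tau,
      sg -> tau = 0 /\ forall n, U (- n) = U n &
      forall m n z, theta (m - 1) <= z -> z <= theta m ->
        U n - U m <= (n%:~R - z) ^+ 2 / 2 - (m%:~R - z) ^+ 2 / 2].
Proof.
move=> mono shift odd.
have [U US] := int_primitive (fun n => n%:~R + 1 / 2 - theta n).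
pose tau := U K - U 0; exists U, tau.
have U1 n : U (n + K) = U n + tau.
  have := @int_stationary (fun n => U (n + K) - U n) n; rewrite add0r /tau => E.
  apply/eqP; rewrite [eqbRHS]addrC -subr_eq E // => n'.
  have -> : n' + 1 + K = n' + K + 1 by lia.
  by rewrite !US shift intrD; ring.
have Uq n q : U (n + q * K) = U n + q%:~R * tau.
  have := @int_stationary (fun q => U (n + q * K) - q%:~R * tau) q.
  rewrite mul0r addr0 mul0r subr0 => E.
  apply/eqP; rewrite -subr_eq E // => q'.
  have -> : n + (q' + 1) * K = n + q' * K + K by lia.
  by rewrite U1 intrD; ring.
have even : sg -> forall n, U (- n) = U n.
  move=> hsg n; have := @int_stationary (fun n => U (- n) - U n) n.
  rewrite oppr0 subrr => E; apply/eqP; rewrite -subr_eq0 E // => n'.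
  have := US (- n' - 1); rewrite subrK => ->.
  have -> : - (n' + 1) = - n' - 1 by lia.
  by rewrite US odd// !intrD !intrN; field.
split=> // [hsg|m n z zm mz].
  split; last exact: even.
  have := U1 (- K); rewrite addNr even // => E.
  by rewrite /tau in E *; lra.
have tmono a c : a <= c -> theta a <= theta c.
  move=> ac; have -> : c = a + `|c - a|%N%:Z by lia.
  elim: `|c - a|%N => [|k IH]; first by rewrite addr0.
  apply: le_trans IH _; have -> : a + k.+1%:Z = a + k%:Z + 1 by lia.
  exact: mono.
have step n' : ((n' + 1)%:~R - z) ^+ 2 / 2 - U (n' + 1) =
    (n'%:~R - z) ^+ 2 / 2 - U n' + (theta n' - z).
  by rewrite US intrD; field.
suff : (m%:~R - z) ^+ 2 / 2 - U m <= (n%:~R - z) ^+ 2 / 2 - U n by lra.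
apply: (@int_unimodal (fun n => (n%:~R - z) ^+ 2 / 2 - U n)) => n' h /=.
  by rewrite step; have := tmono _ _ h; lra.
by rewrite step; have := tmono n' (m - 1) ltac:(lia); lra.
Qed.

End Potential.

(** * A minimal point at summable distance *)

Section Upper.
Variables (R : realType) (J : choiceType) (sg : bool) (K : int) (L p0 C : R).
Variables (m : J -> int) (l y : J -> R) (O : (J -> R) -> Prop).
Hypothesis J_infinite : infinite_set [set: J].
Hypothesis K_gt0 : 0 < K.
Hypothesis LE : L = K%:~R / 2.
Hypothesis p0E : sg -> p0 = 0.
Hypothesis lE : forall j, l j = p0 + (m j)%:~R / 2.
Hypothesis O_start : O l.
Hypothesis O_moved : forall b, O b -> finitely_moved l b.
Hypothesis O_pair : forall i j s k b,
  i != j -> s ==> sg -> O b -> O (pair_move L i j s k b).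
Hypothesis O_bounded : forall b, O b -> - C <= energy l y b.

Let Y (j : J) : R := 2 * (y j - p0).

(** The exchange of the copies (i, s, k) and (j, s', k') is the pair move of
    sign s s' and shift (-1)^s (k' - k).  The factor 4 comes from measuring
    levels and heights in units of 1/2. *)
Lemma exchange_reaches (ps : seq (affine_copy J * affine_copy J)) :
  uniq ([seq index_of p.1 | p <- ps] ++ [seq index_of p.2 | p <- ps]) ->
  all (fun p => admissible sg p.1 && admissible sg p.2) ps ->
  exists b, [/\ O b,
    forall j, j \notin [seq index_of p.1 | p <- ps] ++ [seq index_of p.2 | p <- ps] ->
      b j = l j &
    energy l y b = (\sum_(p <- ps) (level K m p.1 - level K m p.2)%:~R *
                      (height K Y p.1 - height K Y p.2)) / 4].
Proof.
elim: ps => [|[[[i s] k] [[j s'] k']] ps IH] /=.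
  move=> _ _; exists l; split=> //; rewrite /energy.
  by rewrite (@total_changeE _ _ _ _ _ _ [::])// !big_nil mul0r.
rewrite ![index_of (i, _, _)]/index_of ![index_of (j, _, _)]/index_of /=.
set A1 := [seq index_of p.1 | p <- ps]; set A2 := [seq index_of p.2 | p <- ps].
have P : perm_eq (i :: A1 ++ j :: A2) (i :: j :: A1 ++ A2).
  by rewrite perm_cons -(cat1s j A2) perm_catCA.
rewrite -[_ && uniq _]/(uniq (i :: A1 ++ j :: A2)) (perm_uniq P) /= inE negb_or => /and3P[/andP[ij iA] jA uA].
move=> /andP[/andP[ssg ssg'] aps].
have [b [Ob bl bE]] := IH uA aps.
pose k2 : int := (-1) ^+ s * (k' - k).
have s2g : (s (+) s') ==> sg.
  by move: ssg ssg'; rewrite /admissible /=; case: (s) (s') (sg) => [] [] [].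
exists (pair_move L i j (s (+) s') k2 b); split; first exact: O_pair.
  move=> x; rewrite (perm_mem P) !inE !negb_or => /and3P[xi xj xA].
  by rewrite pair_moveC ?bl// !inE negb_or xi.
rewrite energy_pair//; last exact: O_moved.
rewrite bE big_cons !bl// [LHS]addrC [RHS]mulrDl; congr (_ + _).
rewrite /level /height /Y !lE LE /k2 /= intrD !intrN !intrD !intrM.
move: ssg ssg'; rewrite /admissible /=; clear k2 s2g; case: s s' => [] [] /= ;
  rewrite ?expr0 ?expr1; (try move/p0E=> ->); (try move=> _);
  (try move/p0E=> ->); (try move=> _); rewrite ?mulN1r ?mul1r ?intrN; by field.
Qed.

Lemma copies_bounded_exchange : bounded_exchange sg K (4 * C) m Y.
Proof.
move=> ps ups aps; have [b [Ob _ bE]] := exchange_reaches ups aps.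
by have := O_bounded Ob; rewrite bE; lra.
Qed.

Lemma clamp_dist (a c x : R) : a <= c ->
  exists z, [/\ a <= z, z <= c &
    `|z - x| <= Num.max (x - c) 0 + Num.max (a - x) 0].
Proof.
move=> ac; have h0 u : 0 <= Num.max u 0 :> R by rewrite le_max lexx orbT.
have hu u : u <= Num.max u 0 :> R by rewrite le_max lexx.
case: (leP x a) => xa.
  exists a; split=> //; rewrite ger0_norm ?subr_ge0//.
  by have := h0 (x - c); have := hu (a - x); lra.
case: (leP x c) => xc.
  exists x; rewrite subrr normr0; split=> //; first exact: ltW.
  exact: addr_ge0.
exists c; split=> //; rewrite distrC ger0_norm ?subr_ge0; last exact: ltW.
by have := hu (x - c); have := h0 (a - x); lra.
Qed.

(** The centre z is y clamped between the thresholds adjacent to each level;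
    the invariant potential then bounds the energy from below. *)
Theorem minimal_point_exists : exists (z : J -> R) (S : R),
  (forall r, uniq r -> \sum_(j <- r) `|z j - y j| <= S) /\
  forall b, reachable L sg l b -> 0 <= energy l z b.
Proof.
have [theta [C' [mono shift odd sumb]]] :=
  thresholds_exist J_infinite K_gt0 copies_bounded_exchange.
have [U [tau [Uq even pot]]] := potential_exists mono shift odd.
have clamp j : exists z, [/\ theta (m j - 1) <= z, z <= theta (m j) &
    `|z - Y j| <= Num.max (Y j - theta (m j)) 0 + Num.max (theta (m j - 1) - Y j) 0].
  by apply: clamp_dist; have := mono (m j - 1); rewrite subrK.
have [Z ZE] := choice clamp.
exists (fun j => p0 + Z j / 2), C'; split=> [r ur|b rb].
  apply: le_trans (sumb r ur); apply: ler_sum => j _.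
  have [_ _] := ZE j; apply: le_trans.
  have -> : Z j - Y j = 2 * (p0 + Z j / 2 - y j) by rewrite /Y; field.
  by rewrite normrM ger0_norm// ler_peMl// ler1n.
pose P (x : R) := exists n : int, x = p0 + n%:~R / 2.
pose V (x : R) := U (Num.floor (2 * (x - p0))).
have VE (n : int) : V (p0 + n%:~R / 2) = U n.
  rewrite /V; have -> : 2 * (p0 + n%:~R / 2 - p0) = n%:~R :> R by field.
  by rewrite intrKfloor.
have PL k n : p0 + n%:~R / 2 + k%:~R * L = p0 + (n + k * K)%:~R / 2 :> R.
  by rewrite LE intrD intrM; field.
have [||||||Pb Vb] := @reachable_invariant _ _ L sg l P V tau b.
- by move=> _ k [n ->]; exists (n + k * K).
- by move=> hsg _ [n ->]; exists (- n); rewrite p0E// intrN; field.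
- by move=> _ k [n ->]; rewrite PL !VE Uq.
- move=> hsg; have [tau0 Ue] := even hsg; split=> // _ [n ->].
  have -> : - (p0 + n%:~R / 2) = p0 + (- n)%:~R / 2 :> R.
    by rewrite p0E// intrN; field.
  by rewrite !VE.
- by move=> j; exists (m j).
- exact: rb.
have [r0 br0] := reachable_moved rb.
have br j : j \notin undup r0 -> b j = l j by rewrite mem_undup; exact: br0.
have ur := undup_uniq r0.
apply: (@le_trans _ _ (total_change l (fun=> V) b / 4)); first by rewrite Vb mul0r.
rewrite /energy !(total_changeE _ ur br) mulr_suml; apply: ler_sum => j _.
have [n ->] := Pb j; rewrite lE !VE.
have [z1 z2 _] := ZE j; have := pot _ n _ z1 z2.
set u := U n; set v := U _ => h.
apply: (@le_trans _ _ (((n%:~R - Z j) ^+ 2 / 2 - ((m j)%:~R - Z j) ^+ 2 / 2) / 4)).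
  by apply: ler_wpM2r => //; rewrite invr_ge0.
by rewrite le_eqVlt; apply/orP; left; apply/eqP; field.
Qed.

End Upper.

(** * Linear functionals with prescribed values *)

Section Extension.
Variables (R : realType) (V : lmodType R) (J : choiceType).
Variables (v : J -> V) (f : J -> V -> R) (s : J -> R).
Hypothesis f_linear : forall j, linear (f j : V -> R^o).
Hypothesis f_dual : forall i j, f i (v j) = (i == j)%:R.

(** Partial linear functionals are encoded by their graphs, so that unions of
    chains need no gluing. *)
Definition linear_graph (G : set (V * R)) : Prop :=
  (forall c x a y b, G (x, a) -> G (y, b) -> G (c *: x + y, c * a + b)) /\
  (forall a, G (0, a) -> a = 0).

Let span_graph : set (V * R) := [set p | exists (r : seq J) (c : J -> R),
  uniq r /\ p = (\sum_(j <- r) c j *: v j, \sum_(j <- r) c j * s j)].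

Lemma span_linear_graph : linear_graph span_graph.
Proof.
split=> [c x a y b [r [u [ur [-> ->]]]] [r' [u' [ur' [-> ->]]]]|a [r [u [ur [E ->]]]]].
  pose w := undup (r ++ r').
  pose ext (q : seq J) (d : J -> R) j := if j \in q then d j else 0.
  have extE (W : zmodType) (g : J -> R -> W) (q : seq J) d :
      uniq q -> {subset q <= w} -> (forall j, g j 0 = 0) ->
      \sum_(j <- q) g j (d j) = \sum_(j <- w) g j (ext q d j).
    move=> uq qw g0; transitivity (\sum_(j <- q) g j (ext q d j)).
      by rewrite big_seq [RHS]big_seq; apply: eq_bigr => j jq; rewrite /ext jq.
    have out j : j \notin q -> g j (ext q d j) = 0.
      by move=> /negbTE jq; rewrite /ext jq.
    rewrite -(fsum_seq uq out) -(fsum_seq (undup_uniq _) _)// => j jw.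
    by apply: out; apply: contra jw; exact: qw.
  have rw : {subset r <= w} by move=> j jr; rewrite mem_undup mem_cat jr.
  have rw' : {subset r' <= w} by move=> j jr; rewrite mem_undup mem_cat jr orbT.
  exists w, (fun j => c * ext r u j + ext r' u' j); split; first exact: undup_uniq.
  rewrite (extE _ (fun j d => d *: v j) r)//; last by move=> j; rewrite scale0r.
  rewrite (extE _ (fun j d => d *: v j) r')//; last by move=> j; rewrite scale0r.
  rewrite (extE _ (fun j d => d * s j) r)//; last by move=> j; rewrite mul0r.
  rewrite (extE _ (fun j d => d * s j) r')//; last by move=> j; rewrite mul0r.
  congr (_, _).
    rewrite scaler_sumr -big_split; apply: eq_bigr => j _ /=.
    by rewrite scalerA -scalerDl.
  rewrite mulr_sumr -big_split; apply: eq_bigr => j _ /=.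
  by rewrite mulrA -mulrDl.
have coef i : i \in r -> u i = 0.
  move=> ir; have f0 : f i 0 = 0.
    have := f_linear i (-1) 0 0; rewrite scaler0 addr0 scaleN1r => ->.
    exact: addNr.
  have fsum (q : seq J) : f i (\sum_(j <- q) u j *: v j) =
      \sum_(j <- q) u j * (i == j)%:R.
    elim: q => [|j q IH]; first by rewrite !big_nil.
    by rewrite !big_cons f_linear IH f_dual.
  have := fsum r; rewrite -E f0 (bigD1_seq i)//= eqxx mulr1 big1 ?addr0 // => j ji.
  by rewrite eq_sym (negbTE ji) mulr0.
by rewrite big_seq big1 // => j /coef ->; rewrite mul0r.
Qed.

(** Applied to A together with the graph over the span of the v j, the
    property is also met by the union of the empty chain.  In a maximal graph
    the domain is everything, as a missing vector x could be sent to 0. *)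
Theorem linear_extension : exists T : V -> R,
  linear (T : V -> R^o) /\ forall j, T (v j) = s j.
Proof.
pose P (A : set (V * R)) := linear_graph (A `|` span_graph).
have chain F : F `<=` P -> total_on F subset -> P (\bigcup_(X in F) X).
  move=> FP Ftot; have [spD sp0] := span_linear_graph.
  have two p1 q : ((\bigcup_(X in F) X) `|` span_graph) p1 ->
      ((\bigcup_(X in F) X) `|` span_graph) q ->
      (span_graph p1 /\ span_graph q) \/ exists2 X, F X &
        (X `|` span_graph) p1 /\ (X `|` span_graph) q.
    move=> [[X FX Xp]|sp] [[X' FX' Xq]|sq].
    - have [XX|XX] := Ftot _ _ FX FX'; right.
        by exists X' => //; split; left => //; exact: XX.
      by exists X => //; split; left => //; exact: XX.
    - by right; exists X => //; split; [left|right].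
    - by right; exists X' => //; split; [right|left].
    - by left.
  have incl X : F X -> X `|` span_graph `<=` (\bigcup_(X in F) X) `|` span_graph.
    by move=> FX p [Xp|sp]; [left; exists X|right].
  split=> [c x a y b Gx Gy|a [[X FX Xa]|sa]]; last by apply: sp0.
    have [[sx sy]|[X FX [Xx Xy]]] := two _ _ Gx Gy; first by right; apply: spD.
    by apply: (incl _ FX); case: (FP _ FX) => + _; apply.
  by case: (FP _ FX) => _; apply; left.
have [A [[GD G0] Amax]] := Zorn_bigcup chain.
set G := A `|` span_graph in GD G0.
have G00 : G (0, 0).
  by right; exists [::], (fun=> 0); rewrite !big_nil.
have tot x : exists a, G (x, a).
  apply: contrapT => nx.
  pose G' := [set p : V * R | exists c y, G (y, p.2) /\ p.1 = c *: x + y].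
  have GG' : G `<=` G'.
    by move=> [y b] Gy; exists 0, y; rewrite scale0r add0r.
  apply: (Amax G'); last first.
    rewrite /P; have -> : G' `|` span_graph = G'.
      by apply/setUidPl => p sp; apply: GG'; right.
    split=> [c y a z b [d [y' [Gy /= ->]]] [d' [z' [Gz /= ->]]]|a [c [y [Gy /= E]]]].
      exists (c * d + d'), (c *: y' + z'); split; first exact: GD.
      by rewrite scalerDr scalerDl scalerA /= addrACA.
    have [c0|c0] := eqVneq c 0.
      by apply: G0; rewrite [X in G (X, _)]E c0 scale0r add0r.
    case: nx; exists (- c^-1 * a).
    have -> : x = - c^-1 *: y + 0.
      rewrite addr0 scaleNr; apply/eqP; rewrite -addr_eq0.
      by rewrite -[X in X + _](scalerK c0) -scalerDr -E scaler0.
    by rewrite -[_ * a]addr0; exact: GD.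
  split; first by move=> p Ap; apply: GG'; left.
  move=> /(_ (x, 0)) H; apply: nx; exists 0; left; apply: H.
  by exists 1, 0; rewrite scale1r addr0.
have uniqG x a b : G (x, a) -> G (x, b) -> a = b.
  move=> Ga Gb; have := GD (- 1) _ _ _ _ Ga Gb.
  rewrite scaleN1r addNr mulN1r => /G0 /eqP.
  by rewrite addrC subr_eq0 => /eqP.
have [T TG] := choice tot; exists T; split=> [c x y|j].
  by apply: uniqG (TG _) _; exact: GD.
apply: uniqG (TG _) _; right; exists [:: j], (fun=> 1).
by rewrite !big_seq1 scale1r mul1r.
Qed.

End Extension.

(** * Reflections in coordinates *)

Section DualTheory.
Variables (R : realType) (V : lmodType R).
Implicit Types f g : dual V.

Lemma dual_linear f : linear (f : V -> R^o).
Proof. by case: f => f fL; apply/asboolP. Qed.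

Lemma dualD f g w : (f + g : dual V) w = f w + g w.
Proof. by []. Qed.

Lemma dualN f w : (- f : dual V) w = - f w.
Proof. by []. Qed.

Lemma dualZ a f w : (a *: f : dual V) w = a * f w.
Proof. by []. Qed.

Lemma dual_sum (I : Type) (r : seq I) (F : I -> dual V) w :
  (\sum_(i <- r) F i : dual V) w = \sum_(i <- r) F i w.
Proof. by elim: r => [|i r IH]; rewrite ?big_nil // !big_cons dualD IH. Qed.

Lemma dual_ext f g : (forall w, f w = g w) -> f = g.
Proof. by move=> fg; apply/val_inj/funext. Qed.

Lemma dual_0 f : f 0 = 0.
Proof.
have := dual_linear f (-1) 0 0; rewrite scaler0 addr0 scaleN1r => ->.
exact: addNr.
Qed.

Lemma dual_addr f v w : f (v + w) = f v + f w.
Proof. by have := dual_linear f 1 v w; rewrite !scale1r. Qed.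

Lemma dual_scaler f a v : f (a *: v) = a * f v.
Proof. by have := dual_linear f a v 0; rewrite !addr0 dual_0 addr0. Qed.

End DualTheory.

Section Coordinates.
Variables (R : realType) (k : completeNormedModType R) (L : hilbert_lie k).
Variables (t0 : submodClosed k) (kappa : R) (J : choiceType) (e : J -> it0 t0).
Hypothesis e_basis : orthonormal_basis L kappa e.

Local Notation ep := (eps L kappa e).

Lemma eps_dual i j : ep i (e j) = (i == j)%:R.
Proof. exact: (e_basis.1 i j). Qed.

Lemma wt_triple (mu : dual (it0e t0)) a alpha b :
  mu = triple a alpha b -> [/\ wt_c mu = a, wt_0 mu = alpha & wt_d mu = b].
Proof.
move=> ->; split.
- by rewrite /wt_c /fun_of_dual /= dual_0 mul1r mul0r addr0 subr0.
- apply: dual_ext => h; rewrite /fun_of_dual /= /fun_of_dual /=.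
  by rewrite !mul0r add0r subr0.
- by rewrite /wt_d /fun_of_dual /= dual_0 mul0r mulN1r opprK !add0r.
Qed.

Lemma triple_comb (x a a' b b' : R) (alpha alpha' : dual (it0 t0)) :
  triple (x * a + a') (x *: alpha + alpha') (x * b + b') =
  x *: triple a alpha b + triple a' alpha' b'.
Proof.
apply: dual_ext => w; rewrite dualD dualZ /fun_of_dual /=.
rewrite -/(fun_of_dual _) dualD dualZ; ring.
Qed.

(** All the roots, short and long ones included (with q = 0), lie in the plane
    of two basis vectors, so that a single reflection formula covers every
    type. *)
Definition plane_root (i j : J) (p q : R) : dual (it0 t0) :=
  p *: ep i + q *: ep j.

Lemma plane_rootE i j p q x : plane_root i j p q (e x) =
  p * (i == x)%:R + q * (j == x)%:R.
Proof. by rewrite dualD !dualZ !eps_dual. Qed.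

Lemma form_plane i j p q : i != j ->
  Defs.form e (plane_root i j p q) (plane_root i j p q) = p ^+ 2 + q ^+ 2.
Proof.
move=> ij; rewrite /Defs.form (@fsum_seq _ _ _ [:: i; j])/=.
- rewrite !big_cons big_nil !plane_rootE !eqxx (eq_sym j) (negbTE ij) /=; ring.
- by rewrite inE ij.
- move=> x; rewrite !inE negb_or => /andP[xi xj].
  by rewrite plane_rootE (eq_sym i) (eq_sym j) (negbTE xi) (negbTE xj) /=; ring.
Qed.

Lemma sharp_plane i j p q : i != j ->
  sharp e (plane_root i j p q) = p *: e i + q *: e j.
Proof.
move=> ij; rewrite /sharp (@fsum_seq _ _ _ [:: i; j])/=.
- rewrite !big_cons big_nil !plane_rootE !eqxx (eq_sym j) (negbTE ij).
  by rewrite !mulr1 !mulr0 addr0 add0r addr0.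
- by rewrite inE ij.
- move=> x; rewrite !inE negb_or => /andP[xi xj].
  rewrite plane_rootE (eq_sym i) (eq_sym j) (negbTE xi) (negbTE xj).
  by rewrite !mulr0 addr0 scale0r.
Qed.

Lemma coroot_plane (mu : dual (it0e t0)) i j p q n :
  i != j -> p ^+ 2 + q ^+ 2 != 0 ->
  mu (coroot e (triple 0 (plane_root i j p q) n)) =
  2 * (p * mu (of_it0 (e i)) + q * mu (of_it0 (e j)) - n * wt_c mu)
    / (p ^+ 2 + q ^+ 2).
Proof.
move=> ij N0; rewrite /coroot.
have [_ -> ->] := wt_triple (erefl (triple 0 (plane_root i j p q) n)).
rewrite form_plane// sharp_plane// dual_addr dual_scaler.
have mu0 h : mu (of_it0 h) = wt_0 mu h by [].
rewrite !mu0 dual_scaler dual_addr !dual_scaler /wt_c.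
by field.
Qed.

Section Orbit.
Variable lambda : dual (it0e t0).
Hypothesis lambda_c : wt_c lambda != 0.

Definition coords (j : J) : R := lambda (of_it0 (e j)).

(** The last component is the one for which the invariant form
    (mu^0, mu^0) - 2 mu_c mu_d takes the same value as at lambda. *)
Definition weight_at (b : J -> R) : dual (it0e t0) :=
  lambda + triple 0 (total_change coords (fun j x => x *: ep j) b)
    (total_change coords (fun=> fun x => x ^+ 2) b / (2 * wt_c lambda)).

Lemma weight_at_start : weight_at coords = lambda.
Proof.
rewrite /weight_at !(@total_changeE _ _ _ _ _ _ [::])// !big_nil mul0r.
apply: dual_ext => w; rewrite dualD /fun_of_dual /=.
by rewrite /fun_of_dual /= !mulr0 !addr0 subr0 addr0.
Qed.

Lemma weight_at_c b : wt_c (weight_at b) = wt_c lambda.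
Proof.
rewrite /wt_c /weight_at dualD.
set t := triple _ _ _; have [+ _ _] := wt_triple (erefl t).
by rewrite /wt_c => ->; rewrite addr0.
Qed.

Lemma weight_at_coord b i : finitely_moved coords b ->
  weight_at b (of_it0 (e i)) = b i.
Proof.
move=> [r br]; rewrite /weight_at dualD.
set t := triple _ _ _; have [_ t0E _] := wt_triple (erefl t).
have -> : t (of_it0 (e i)) = wt_0 t (e i) by [].
have br' x : x \notin undup r -> b x = coords x by rewrite mem_undup; exact: br.
rewrite t0E (total_changeE _ (undup_uniq r) br') dual_sum.
have -> : \sum_(j <- undup r) (b j *: ep j - coords j *: ep j : dual (it0 t0)) (e i) =
          \sum_(j <- undup r) (b j - coords j) * (j == i)%:R.
  by apply: eq_bigr => j _; rewrite dualD dualN !dualZ eps_dual mulrBl.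
rewrite -[lambda _]/(coords i).
have [ir|ir] := boolP (i \in undup r).
  rewrite (bigD1_seq i) ?undup_uniq//= eqxx mulr1 big1 ?addr0 => [|j /negbTE ->].
    by rewrite addrC subrK.
  by rewrite mulr0.
rewrite big_seq big1 => [|j jr]; first by rewrite addr0 br'.
by case: eqP => [ji|_]; rewrite ?mulr0 // -ji jr in ir *.
Qed.

Lemma reflection_weight_at b i j p q n : finitely_moved coords b ->
  i != j -> p ^+ 2 + q ^+ 2 != 0 ->
  let t := 2 * (p * b i + q * b j - n * wt_c lambda) / (p ^+ 2 + q ^+ 2) in
  reflection e (triple 0 (plane_root i j p q) n) (weight_at b) =
  weight_at (fun x => if x == i then b i - t * p
                      else if x == j then b j - t * q else b x).
Proof.
move=> fb ij N0 t; set b' := (fun x => _).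
rewrite /reflection coroot_plane// !weight_at_coord// weight_at_c -/t.
have b'b x : x \notin [:: i; j] -> b' x = b x.
  by rewrite !inE negb_or /b' => /andP[/negbTE -> /negbTE ->].
have u2 : uniq [:: i; j] by rewrite /= inE ij.
have ji : (j == i) = false by rewrite eq_sym (negbTE ij).
rewrite /weight_at !(total_change_change _ fb u2 b'b) !big_cons !big_nil !addr0.
rewrite /b' eqxx ji eqxx.
rewrite -addrA; congr (_ + _); rewrite addrC -scaleNr -triple_comb.
congr triple; first by rewrite mulr0 addr0.
  rewrite addrC; congr (_ + _); rewrite -!scalerBl /plane_root scalerDr !scalerA.
  have E (x y : R) : x - t * y - x = - t * y.
    by rewrite addrAC subrr sub0r mulNr.
  by rewrite !E.
have tE : t * (p ^+ 2 + q ^+ 2) = 2 * (p * b i + q * b j - n * wt_c lambda).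
  by rewrite /t divfK.
clear b' b'b; clearbody t; move: (b i) (b j) (total_change _ _ b) (wt_c lambda) lambda_c tE.
move=> x y Q c c0 tE.
have -> : (x - t * p) ^+ 2 - x ^+ 2 + ((y - t * q) ^+ 2 - y ^+ 2) =
          t * (t * (p ^+ 2 + q ^+ 2)) - 2 * t * (p * x + q * y) by ring.
by rewrite tE; field.
Qed.

End Orbit.
End Coordinates.

(** * Compact roots of the standard affinisations *)

Definition signed_type (X : aff_type) : bool :=
  match X with A1 => false | _ => true end.

(** In the type B2 the roots +- eps_i +- eps_j occur only with even n, which
    doubles the period of the pair moves. *)
Definition stride (X : aff_type) : int := match X with B2 => 2 | _ => 1 end.

Section StandardOrbit.
Variables (R : realType) (k : completeNormedModType R) (L : hilbert_lie k).
Variables (phi : k -> k) (N : nat) (t0 : submodClosed k).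
Variables (X : aff_type) (kappa : R) (J : choiceType) (e : J -> it0 t0).
Hypothesis g_standard : standard_affinisation L phi N kappa e X.

Let J_infinite : infinite_set [set: J] := std_infinite g_standard.
Local Notation ep := (eps L kappa e).
Local Notation plane := (plane_root L kappa e).
Local Notation sg := (signed_type X).

Lemma compact_rootP gamma : compact_root L phi N (t0 := t0) gamma <->
  exists alpha n, aff_roots L kappa e X (alpha, n) /\
                  gamma = triple 0 alpha n%:~R.
Proof.
have E := std_roots g_standard.
have -> : compact_root L phi N gamma =
    [set triple 0 p.1 p.2%:~R | p in aff_roots L kappa e X] gamma.
  by rewrite -E.
split=> [[[alpha n] An <-]|[alpha [n [An ->]]]]; first by exists alpha, n.
by exists (alpha, n).
Qed.

Definition pair_root (i j : J) (s u : bool) : dual (it0 t0) :=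
  plane i j ((-1) ^+ u) (- ((-1) ^+ u * (-1) ^+ s)).

Lemma pair_rootE i j :
  [/\ pair_root i j false false = ep i - ep j,
      pair_root i j true false = ep i + ep j,
      pair_root i j true true = - (ep i + ep j) &
      pair_root i j false true = - (ep i - ep j)].
Proof.
split; rewrite /pair_root /plane_root ?expr0 ?expr1 ?mulr1 ?mul1r ?mulrNN ?mulr1;
  by rewrite ?opprK ?scaleN1r ?scale1r ?opprB ?opprD // addrC.
Qed.

Lemma roots_DP alpha : roots_D L kappa e alpha <->
  exists i j s u, i != j /\ alpha = pair_root i j s u.
Proof.
split=> [[i [j [/eqP ij]]]|[i [j [s [u [/eqP ij ->]]]]]].
  have [E1 E2 E3 E4] := pair_rootE i j.
  case=> ->; exists i, j; [exists true, false|exists true, true|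
    exists false, false|exists false, true]; by rewrite ?E1 ?E2 ?E3 ?E4.
exists i, j; split=> //; have [E1 E2 E3 E4] := pair_rootE i j.
case: s u => [] []; rewrite ?E1 ?E2 ?E3 ?E4;
  by [apply: Or41|apply: Or42|apply: Or43|apply: Or44].
Qed.

Lemma pair_root_compact i j s n : i != j -> s ==> sg ->
  compact_root L phi N (triple 0 (pair_root i j s false) (stride X * n)%:~R).
Proof.
move=> ij ssg; apply/compact_rootP; exists (pair_root i j s false), (stride X * n).
split=> //.
have D : roots_D L kappa e (pair_root i j s false).
  by apply/roots_DP; exists i, j, s, false.
have even_or m : evenz m \/ oddz m by apply: EM.
have [E1 _ _ _] := pair_rootE i j.
case: (X) ssg => /= ssg; rewrite ?mul1r.
- move: ssg D; case: (s) => //= _ _; split=> //=.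
  by exists i, j; split; [exact/eqP|].
- by split=> //=; left.
- by split=> //=; left.
- by split.
- by left; split; [left|exact: dvdz_mulr].
- have [m0|m0] := even_or n; [left|right]; split=> //=; by left.
- have [m0|m0] := even_or n; [left|right]; split=> //=; first by left.
  by left; left.
Qed.

(** The condition on 2 n / p says that the sign move of a root p eps_i shifts
    by a multiple of the stride: in the type B2, where the stride is 2, only
    short roots occur, and in the other types the stride is 1. *)
Lemma compact_root_shape gamma : compact_root L phi N (t0 := t0) gamma ->
  (exists i j s u n, [/\ i != j, s ==> sg &
     gamma = triple 0 (pair_root i j s u) (stride X * n)%:~R]) \/
  (sg /\ exists i j p n (m : int), [/\ i != j, p != 0,
     2 * n / p = m%:~R * (stride X)%:~R & gamma = triple 0 (plane i j p 0) n]).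
Proof.
move=> /compact_rootP[alpha [n [An ->]]].
have pairD : sg -> roots_D L kappa e alpha -> (stride X %| n)%Z ->
  (exists i j s u n', [/\ i != j, s ==> sg &
     triple 0 alpha n%:~R =
     triple 0 (pair_root i j s u) (stride X * n')%:~R]).
  move=> hsg /roots_DP[i [j [s [u [ij ->]]]]] /dvdzP[n' ->].
  by exists i, j, s, u, n'; split; rewrite ?hsg ?implybT// mulrC.
have other (i : J) : exists j, i != j.
  have [j _ jr] := infinite_fresh [:: i] J_infinite.
  by exists j; move: jr; rewrite inE eq_sym.
have single (i : J) (p : R) m : sg -> p != 0 -> alpha = p *: ep i ->
    2 * n%:~R / p = m%:~R * (stride X)%:~R ->
  (sg /\ exists i j p n' (m : int), [/\ i != j, p != 0,
     2 * n' / p = m%:~R * (stride X)%:~R &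
     triple 0 alpha n%:~R = triple 0 (plane i j p 0) n' :> dual (it0e t0)]).
  move=> hsg p0 -> mE; split=> //; have [j ij] := other i.
  exists i, j, p, n%:~R, m; split=> //; congr triple.
  by rewrite /plane_root scale0r addr0.
have short : sg -> (stride X %| 2)%Z -> roots_short L kappa e alpha ->
    (sg /\ exists i j p n' (m : int), [/\ i != j, p != 0,
     2 * n' / p = m%:~R * (stride X)%:~R &
     triple 0 alpha n%:~R = triple 0 (plane i j p 0) n' :> dual (it0e t0)]).
  move=> hsg /dvdzP[q qE] [i aE].
  have qR : q%:~R * (stride X)%:~R = 2 :> R by rewrite -intrM -qE.
  case: aE => aE.
    apply: (single i 1 (n * q)) => //; rewrite ?oner_neq0 ?scale1r//.
    by rewrite intrM -[RHS]mulrA qR divr1 mulrC.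
  apply: (single i (-1) (- (n * q))) => //; rewrite ?oppr_eq0 ?oner_neq0 ?scaleN1r//.
  by rewrite intrN intrM mulNr -[X in _ = - X]mulrA qR invrN1 mulrN1 mulrC.
have long : sg -> stride X = 1 -> roots_long L kappa e alpha ->
    (sg /\ exists i j p n' (m : int), [/\ i != j, p != 0,
     2 * n' / p = m%:~R * (stride X)%:~R &
     triple 0 alpha n%:~R = triple 0 (plane i j p 0) n' :> dual (it0e t0)]).
  move=> hsg s1 [i [aE|aE]].
    apply: (single i 2 n) => //; rewrite ?scaler_nat//.
    by rewrite s1 mulr1 mulrAC divff// mul1r.
  apply: (single i (-2) (- n)) => //; rewrite ?oppr_eq0// ?scaleNr ?scaler_nat//.
  by rewrite s1 mulr1 invrN mulrN mulrAC divff// mul1r intrN.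
have dvd1 : stride X = 1 -> (stride X %| n)%Z by move=> ->; exact: dvd1z.
move: pairD short long dvd1 An {single}; case: (X) => /= pairD short long dvd1.
- case=> -[i [j [/eqP ij aE]]] _; left; exists i, j, false, false, n.
  by split=> //; rewrite mul1r; have [-> _ _ _] := pair_rootE i j; rewrite -aE.
- by case=> -[D|S] _; [left; apply: pairD|right; apply: short]; rewrite ?dvd1.
- by case=> -[D|S] _; [left; apply: pairD|right; apply: long]; rewrite ?dvd1.
- by case=> D _; left; apply: pairD; rewrite ?dvd1.
- case=> -[].
    by case=> [D|S] ev; [left; apply: pairD|right; apply: short].
  by move=> S _; right; apply: short.
- case=> -[].
    by case=> [D|S] ev; [left; apply: pairD|right; apply: long]; rewrite ?dvd1.
  by move=> D _; left; apply: pairD; rewrite ?dvd1.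
- case=> -[].
    by case=> [D|S] ev; [left; apply: pairD|right; apply: short]; rewrite ?dvd1.
  case=> -[D|S] ev; try by left; apply: pairD; rewrite ?dvd1.
    by right; apply: short.
  by right; apply: long.
Qed.

End StandardOrbit.

(** * The Weyl orbit in coordinates *)

Lemma pair_moveK (R : realType) (J : choiceType) (L : R) (i j : J) s m :
  i != j -> involutive (pair_move L i j s m).
Proof.
move=> ij b; apply/funext => x; have ji : (j == i) = false by rewrite eq_sym (negbTE ij).
rewrite /pair_move !eqxx ji; case: eqP => [->|_].
  by case: s; rewrite ?expr0 ?expr1; ring.
by case: eqP => [->|//]; case: s; rewrite ?expr0 ?expr1; ring.
Qed.

Lemma sign_moveK (R : realType) (J : choiceType) (L : R) (i : J) m :
  involutive (sign_move L i m).
Proof.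
move=> b; apply/funext => x; rewrite /sign_move eqxx; case: eqP => [->|//].
by rewrite opprD opprK subrK.
Qed.

Section WeylOrbit.
Variables (R : realType) (k : completeNormedModType R) (L : hilbert_lie k).
Variables (phi : k -> k) (N : nat) (t0 : submodClosed k).
Variables (X : aff_type) (kappa : R) (J : choiceType) (e : J -> it0 t0).
Hypothesis g_standard : standard_affinisation L phi N kappa e X.
Variable lambda : dual (it0e t0).
Hypothesis lambda_c_neq0 : wt_c lambda != 0.

Let e_basis : orthonormal_basis L kappa e := std_basis g_standard.
Local Notation sg := (signed_type X).
Local Notation c := (wt_c lambda).
Local Notation l := (coords e lambda).
Local Notation wt := (weight_at L kappa e lambda).

(** The absolute value only serves to have a positive period; as n ranges over
    all integers, the sign of c is immaterial ([sign_of_c]). *)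
Definition period : R := (stride X)%:~R * `|c|.

Lemma stride_gt0 : 0 < stride X.
Proof. by case: X. Qed.

Lemma period_gt0 : 0 < period.
Proof. by rewrite mulr_gt0 ?ltr0z ?stride_gt0 // normr_gt0. Qed.

Lemma sign_of_c : exists2 v : int, v%:~R * v%:~R = 1 :> R & c = v%:~R * `|c|.
Proof.
case: (ltP c 0) => c0; [exists (-1)|exists 1]; rewrite ?intrN ?mulrNN ?mulr1//.
  by rewrite ltr0_norm// mulrNN mul1r.
by rewrite ger0_norm// mul1r.
Qed.

Lemma reflection_effect gamma : compact_root L phi N (t0 := t0) gamma ->
  exists g : (J -> R) -> J -> R, [/\ involutive g,
    forall b, finitely_moved l b -> reflection e gamma (wt b) = wt (g b) &
    forall b, reachable period sg l b -> reachable period sg l (g b)].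
Proof.
have [v vv cE] := sign_of_c.
move=> /(compact_root_shape g_standard)
  [[i [j [s [u [n [ij ssg ->]]]]]]|[hsg [i [j [p [n [m [ij p0 mE ->]]]]]]]].
  exists (pair_move period i j s ((-1) ^+ u * n * v)); split.
  - exact: pair_moveK.
  - move=> b fb; rewrite /pair_root reflection_weight_at//; last first.
      by case: s u {ssg} => [] [] /=; rewrite ?expr0 ?expr1; apply: lt0r_neq0; lra.
    congr (weight_at _ _ _ _); apply/funext => x; rewrite /pair_move /period.
    rewrite [in LHS]cE; set a := `|c|; rewrite !intrM.
    have -> : ((-1) ^+ u)%:~R = (-1) ^+ u :> R by rewrite rmorphXn /= intrN.
    case: eqP => _; first by case: s u {ssg} => [] [] /=; rewrite ?expr0 ?expr1; field.
    by case: eqP => // _; case: s u {ssg} => [] [] /=; rewrite ?expr0 ?expr1; field.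
  - by move=> b rb; apply: reach_pair.
exists (sign_move period i (m * v)); split.
- exact: sign_moveK.
- move=> b fb; rewrite reflection_weight_at//; last by rewrite expr0n addr0 expf_neq0.
  congr (weight_at _ _ _ _); apply/funext => x; rewrite /sign_move /period.
  rewrite [in LHS]cE; set a := `|c|; rewrite intrM.
  have -> : (m%:~R * v%:~R * ((stride X)%:~R * a)) = 2 * n / p * (v%:~R * a) :> R.
    by rewrite mE; ring.
  case: eqP => [_|_]; first by field.
  by case: eqP => [->|//]; rewrite mulr0 subr0.
- by move=> b rb; apply: reach_sign.
Qed.

(** The inverse g' is carried along because the group is also closed under
    inverses of arbitrary elements, which act on the weights of the orbit
    through g'. *)
Lemma weyl_effect w : weyl L phi N e w -> exists g g' : (J -> R) -> J -> R,
  [/\ cancel g g', cancel g' g,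
      forall b, reachable period sg l b -> w (wt b) = wt (g b),
      forall b, reachable period sg l b -> reachable period sg l (g b) &
      forall b, reachable period sg l b -> reachable period sg l (g' b)].
Proof.
elim=> {w} [gamma /reflection_effect[g [gK gE gr]]||w w' _ [g [g1 [gK g1K gE gr g1r]]]
    _ [h [h1 [hK h1K hE hr h1r]]]|w w' _ [g [g1 [gK g1K gE gr g1r]]] wK w'K].
- by exists g, g; split=> // b /reachable_moved; exact: gE.
- by exists id, id.
- exists (g \o h), (h1 \o g1); split.
  + by move=> b /=; rewrite gK hK.
  + by move=> b /=; rewrite h1K g1K.
  + by move=> b rb /=; rewrite hE// gE//; exact: hr.
  + by move=> b rb /=; apply/gr/hr.
  + by move=> b rb /=; apply/h1r/g1r.
- exists g1, g; split=> // b rb; rewrite -{1}(g1K b) -gE ?wK//.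
  exact: g1r.
Qed.

Definition weyl_orbit (b : J -> R) : Prop :=
  reachable period sg l b /\ exists2 w, weyl L phi N e w & w lambda = wt b.

Lemma weyl_image w : weyl L phi N e w -> exists2 b, weyl_orbit b & w lambda = wt b.
Proof.
move=> ww; have [g [g' [_ _ gE gr _]]] := weyl_effect ww.
have wl : w lambda = wt (g l).
  by rewrite -gE ?weight_at_start//; exact: reach_start.
exists (g l) => //; split; first by apply/gr/reach_start.
by exists w.
Qed.

Lemma weyl_orbit_start : weyl_orbit l.
Proof.
split; first exact: reach_start.
by exists id; [exact: weyl_id|rewrite weight_at_start].
Qed.

Lemma weyl_orbit_moved b : weyl_orbit b -> finitely_moved l b.
Proof. by case=> /reachable_moved. Qed.

Lemma weyl_orbit_pair i j s m b : i != j -> s ==> sg -> weyl_orbit b ->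
  weyl_orbit (pair_move period i j s m b).
Proof.
move=> ij ssg [rb [w ww wE]]; split; first exact: reach_pair.
have [v vv cE] := sign_of_c.
have cr := pair_root_compact g_standard (m * v) ij ssg.
exists (reflection e (triple 0 (pair_root L kappa e i j s false) (stride X * (m * v))%:~R) \o w).
  by apply: weyl_comp => //; exact: weyl_refl.
rewrite /= wE /pair_root reflection_weight_at//; first last.
- by case: s {ssg cr} => /=; rewrite ?expr0 ?expr1; apply: lt0r_neq0; lra.
- exact: reachable_moved rb.
congr (weight_at _ _ _ _); apply/funext => x; rewrite /pair_move /period.
rewrite [in LHS]cE; set a := `|c|; rewrite !intrM.
have -> : (stride X)%:~R * (m%:~R * v%:~R) * (v%:~R * a) =
          m%:~R * ((stride X)%:~R * a) * (v%:~R * v%:~R) :> R by ring.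
rewrite vv mulr1; case: eqP => _.
  by case: s {ssg cr} => /=; rewrite ?expr0 ?expr1; field.
by case: eqP => // _; case: s {ssg cr} => /=; rewrite ?expr0 ?expr1; field.
Qed.

Lemma weyl_orbit_sum : ~~ sg -> forall b, weyl_orbit b -> total_change l (fun=> id) b = 0.
Proof.
move=> /negP nsg b [rb _].
by have [] := @reachable_invariant _ _ period sg l (fun=> True) id period b.
Qed.

End WeylOrbit.

(** * Characters as energies *)

Lemma summableP (R : realType) (J : choiceType) (x : J -> R) :
  summable [set: J] (fun j => (x j)%:E) <->
  exists S, forall r, uniq r -> \sum_(j <- r) `|x j| <= S.
Proof.
split=> [sx|[S xS]].
  exists (fine (\esum_(j in [set: J]) `|(x j)%:E|)%E) => r ur.
  rewrite -lee_fin fineK; last by move: sx; rewrite summableE.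
  apply: esum_ge; exists [set` r]; first by split=> //; exact: finite_seq.
  rewrite -fsbig_seq//; under [leRHS]eq_bigr do rewrite abse_EFin.
  by rewrite sumEFin.
rewrite /summable; apply: (@le_lt_trans _ _ S%:E); last exact: ltry.
apply: ge_ereal_sup => _ [A [fA _] <-].
have [s0 sE] := (finite_seqP _).1 fA.
have E : A = [set` undup s0] by rewrite sE; apply/seteqP; split=> j /=; rewrite mem_undup.
rewrite E -fsbig_seq ?undup_uniq//.
by under eq_bigr do rewrite abse_EFin; rewrite sumEFin lee_fin; exact/xS/undup_uniq.
Qed.

Section Energy.
Variables (R : realType) (k : completeNormedModType R) (L : hilbert_lie k).
Variables (t0 : submodClosed k) (kappa : R) (J : choiceType) (e : J -> it0 t0).
Variable lambda : dual (it0e t0).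
Hypothesis lambda_c_neq0 : wt_c lambda != 0.

Local Notation ep := (eps L kappa e).

(** The point y_j = - chi_j / a with a = chi_d / lambda_c. *)
Definition energy_center (chi : dual (dual (it0e t0))) (j : J) : R :=
  - (char_0 chi (ep j) * wt_c lambda / char_d chi).

Lemma char_triple (chi : dual (dual (it0e t0))) alpha b :
  chi (triple 0 alpha b) = char_0 chi alpha + b * char_d chi.
Proof.
have -> : triple 0 alpha b = triple 0 alpha 0 + b *: triple 0 0 1 :> dual (it0e t0).
  apply: dual_ext => w; rewrite dualD dualZ /fun_of_dual /=.
  have -> : (0 : dual (it0 t0)) w.1.2 = 0 by [].
  by ring.
by rewrite dual_addr dual_scaler.
Qed.

Lemma char_0_sum (chi : dual (dual (it0e t0))) (r : seq J) (a : J -> R) :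
  char_0 chi (\sum_(j <- r) a j *: ep j) = \sum_(j <- r) a j * char_0 chi (ep j).
Proof.
rewrite /char_0; elim: r => [|j r IH].
  rewrite !big_nil -[RHS](dual_0 chi); congr (chi _).
  apply: dual_ext => w; rewrite /fun_of_dual /=.
  have -> : (0 : dual (it0 t0)) w.1.2 = 0 by [].
  by rewrite !mulr0 addr0 subr0.
rewrite !big_cons -IH -dual_scaler -dual_addr -triple_comb; congr (chi _).
by rewrite !mulr0 !addr0.
Qed.

Lemma char_weight_at (chi : dual (dual (it0e t0))) b : char_d chi != 0 ->
  finitely_moved (coords e lambda) b ->
  chi (weight_at L kappa e lambda b - lambda) =
  char_d chi / wt_c lambda * energy (coords e lambda) (energy_center chi) b.
Proof.
move=> d0 [r0 br0].
have ur := undup_uniq r0; set r := undup r0 in ur *.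
have br x : x \notin r -> b x = coords e lambda x by rewrite mem_undup; exact: br0.
rewrite /weight_at addrC addKr char_triple /energy !(total_changeE _ ur br).
have -> : \sum_(j <- r) (b j *: ep j - coords e lambda j *: ep j) =
          \sum_(j <- r) (b j - coords e lambda j) *: ep j.
  by apply: eq_bigr => j _; rewrite scalerBl.
rewrite char_0_sum !mulr_suml mulr_sumr -big_split; apply: eq_bigr => j _ /=.
by rewrite /energy_center; field; rewrite lambda_c_neq0 d0.
Qed.

End Energy.

Section Main.
Variables (R : realType) (k : completeNormedModType R) (L : hilbert_lie k).
Variables (phi : k -> k) (N : nat) (t0 : submodClosed k).
Variables (X : aff_type) (kappa : R) (J : choiceType) (e : J -> it0 t0).
Hypothesis g_standard : standard_affinisation L phi N kappa e X.
Variable lambda : dual (it0e t0).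
Hypothesis lambda_integral : integral_weight L phi N e lambda.
Hypothesis lambda_c_neq0 : wt_c lambda != 0.

Let e_basis : orthonormal_basis L kappa e := std_basis g_standard.
Let J_infinite : infinite_set [set: J] := std_infinite g_standard.
Local Notation sg := (signed_type X).
Local Notation c := (wt_c lambda).
Local Notation l := (coords e lambda).
Local Notation P := (period X lambda).
Local Notation orbit := (weyl_orbit L phi N X kappa e lambda).

Lemma inf_energy_geP chi B : 0 < c * char_d chi ->
  (B%:E <= inf_energy L phi N e lambda chi)%E <->
  forall b, orbit b ->
    B <= char_d chi / c * energy l (energy_center L kappa e lambda chi) b.
Proof.
move=> cd; have d0 : char_d chi != 0 by apply: contraTneq cd => ->; rewrite mulr0 ltxx.
split=> [h b ob|h].
  have := ob; case=> rb [w ww wE].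
  rewrite -lee_fin -char_weight_at//; last exact: reachable_moved rb.
  by apply: le_trans h _; apply: ereal_inf_lbound; exists w => //; rewrite wE.
apply: le_ereal_inf_tmp => _ [w ww <-].
have [b ob ->] := weyl_image g_standard lambda_c_neq0 ww.
by rewrite lee_fin char_weight_at//; [exact: h|exact: weyl_orbit_moved ob].
Qed.

Lemma integral_pair i j s n : i != j -> s ==> sg ->
  l i - (-1) ^+ s * l j - (stride X * n)%:~R * c \is a Num.int.
Proof.
move=> ij ssg; have := lambda_integral (pair_root_compact g_standard n ij ssg).
rewrite /pair_root coroot_plane//; last first.
  by case: s {ssg} => /=; rewrite ?expr0 ?expr1; apply: lt0r_neq0; lra.
congr (_ \is a _); rewrite -/(l i) -/(l j).
by case: s {ssg} => /=; rewrite ?expr0 ?expr1; field.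
Qed.

Lemma period_int : P \is a Num.int.
Proof.
have [i _ _] := infinite_fresh [::] J_infinite.
have [j _ ji] := infinite_fresh [:: i] J_infinite.
have ij : i != j by move: ji; rewrite inE eq_sym.
have h0 := integral_pair 0 ij (isT : false ==> sg).
have h1 := integral_pair 1 ij (isT : false ==> sg).
have Pc : (stride X)%:~R * c \is a Num.int.
  have -> : (stride X)%:~R * c = (l i - (-1) ^+ false * l j - (stride X * 0)%:~R * c)
     - (l i - (-1) ^+ false * l j - (stride X * 1)%:~R * c).
    by rewrite mulr0 mulr1; ring.
  exact: rpredB.
have -> : P = `|(stride X)%:~R * c|.
  by rewrite normrM ger0_norm// ler0z; case: (X).
by case: (ler0P ((stride X)%:~R * c)) => _; rewrite ?rpredN.
Qed.

(** With sign changes twice l_j is the sum of l_j - l_i and l_j + l_i, both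
    integral.  Without them only the differences are integral, but then the
    grid may be centred at any l_(i0). *)
Lemma coords_half_int : exists p0 : R, (sg -> p0 = 0) /\
  exists m : J -> int, forall j, l j = p0 + (m j)%:~R / 2.
Proof.
have [i0 _ _] := infinite_fresh [::] J_infinite.
have mk p0 : (forall j, 2 * (l j - p0) \is a Num.int) ->
    exists m : J -> int, forall j, l j = p0 + (m j)%:~R / 2.
  move=> h; have /choice[m mE] : forall j, exists z : int, 2 * (l j - p0) = z%:~R.
    by move=> j; have /intrP[z ->] := h j; exists z.
  by exists m => j; rewrite -mE; field.
have int_pair i j s : i != j -> s ==> sg -> l i - (-1) ^+ s * l j \is a Num.int.
  by move=> ij ssg; have := integral_pair 0 ij ssg; rewrite mulr0 mul0r subr0.
have [hsg|hsg] := boolP sg.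
  exists 0; split=> //; apply: mk => j.
  have [i _ ij] := infinite_fresh [:: j] J_infinite.
  have ji : j != i by move: ij; rewrite inE eq_sym.
  have -> : 2 * (l j - 0) = (l j - (-1) ^+ false * l i) + (l j - (-1) ^+ true * l i).
    by rewrite expr0 expr1; ring.
  by apply: rpredD; apply: int_pair.
exists (l i0); split; first by move=> h; case/negP: hsg.
apply: mk => j; have [->|ji] := eqVneq j i0; first by rewrite subrr mulr0 rpred0.
rewrite mulr_natl rpredMn//; have := int_pair j i0 false ji isT.
by rewrite expr0 mul1r.
Qed.

Lemma orbit_minimal_point y C : (forall b, orbit b -> - C <= energy l y b) ->
  exists (z : J -> R) (S : R),
  (forall r, uniq r -> \sum_(j <- r) `|z j - y j| <= S) /\
  forall b, orbit b -> 0 <= energy l z b.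
Proof.
move=> yC; have /intrP[q qE] := period_int.
have [p0 [p00 [m mE]]] := coords_half_int.
have P0 := period_gt0 X lambda_c_neq0.
have K0 : 0 < q * 2 by rewrite pmulr_lgt0// -(ltr0z R) -qE.
have PE : P = (q * 2)%:~R / 2 by rewrite intrM -qE; field.
have [z [S [zS zr]]] := minimal_point_exists J_infinite K0 PE p00 mE
  (weyl_orbit_start L phi N X kappa e lambda) (@weyl_orbit_moved _ _ _ _ _ _ _ _ _ _ _)
  (weyl_orbit_pair g_standard lambda_c_neq0) yC.
by exists z, S; split=> // b [rb _]; exact: zr.
Qed.

(** Factoring through the restriction of weights to i t_0 makes the components
    c and d vanish. *)
Lemma char_shift_exists (s : J -> R) : exists chi : dual (dual (it0e t0)),
  [/\ char_c chi = 0, char_d chi = 0 & forall j, char_0 chi (eps L kappa e j) = s j].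
Proof.
have evL j : linear ((fun alpha : dual (it0 t0) => alpha (e j)) :
    dual (it0 t0) -> R^o).
  by move=> a f g; rewrite dualD dualZ.
have evD i j : (eps L kappa e j : dual (it0 t0)) (e i) = (i == j)%:R.
  by rewrite (eps_dual e_basis) eq_sym.
have [T [Tlin Ts]] := linear_extension s evL evD.
have chi_lin : linear ((fun mu => T (wt_0 mu)) : dual (it0e t0) -> R^o).
  move=> a mu nu; rewrite -Tlin; congr (T _).
  by apply: dual_ext.
have T0 : T 0 = 0 by exact: (dual_0 (mk_dual Tlin)).
exists (mk_dual chi_lin); split.
- rewrite /char_c /fun_of_dual /=.
  by have [_ -> _] := wt_triple (erefl (triple 1 (0 : dual (it0 t0)) 0)).
- rewrite /char_d /fun_of_dual /=.
  by have [_ -> _] := wt_triple (erefl (triple 0 (0 : dual (it0 t0)) 1)).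
- move=> j; rewrite /char_0 /fun_of_dual /=.
  by have [_ -> _] := wt_triple (erefl (triple 0 (eps L kappa e j) 0)).
Qed.

End Main.

Theorem theorem1 (R : realType) (k : completeNormedModType R)
  (L : hilbert_lie k) (phi : {linear k -> k}) (N : nat) (t0 : submodClosed k)
  (X : aff_type) (kappa : R) (J : choiceType) (e : J -> it0 t0)
  (k_infinite : infinite_dimensional k)
  (k_simple : simple_hilbert_lie L)
  (phi_aut : hilbert_lie_aut L phi)
  (phi_order : map_has_order phi N)
  (t0_maximal : maximal_abelian_in_fixed L phi t0)
  (g_standard : standard_affinisation L phi N kappa e X)
  (lambda : dual (it0e t0))
  (lambda_integral : integral_weight L phi N e lambda)
  (lambda_c_neq0 : wt_c lambda <> 0)
  (chi : dual (dual (it0e t0)))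
  (lambda_chi_gt0 : 0 < wt_c lambda * char_d chi) :
  (-oo < inf_energy L phi N e lambda chi)%E
  <->
  exists chi_min chi_sum : dual (dual (it0e t0)),
    [/\ minimal_energy L phi N e lambda chi_min,
        summable_char L kappa e chi_sum &
        chi = chi_min + chi_sum].
Proof.
have c0 : wt_c lambda != 0 by exact/eqP.
have d0 : char_d chi != 0.
  by apply: contraTneq lambda_chi_gt0 => ->; rewrite mulr0 ltxx.
pose a := char_d chi / wt_c lambda.
have a0 : 0 < a.
  have -> : a = wt_c lambda * char_d chi / wt_c lambda ^+ 2 by rewrite /a; field.
  by rewrite divr_gt0// exprn_even_gt0.
pose ctr chi := energy_center L kappa e lambda chi.
split=> [infN|[chi_min [chi_sum [chi_min0 [_ sum_d sum_s] chiE]]]].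
- have [B BE] : exists B : R, (B%:E <= inf_energy L phi N e lambda chi)%E.
    move: infN; case: (inf_energy _ _ _ _ _ _) => [r| |] // _.
      by exists r.
    by exists 0; rewrite leey.
  have /(inf_energy_geP g_standard c0 _ lambda_chi_gt0) h := BE.
  have hC b : weyl_orbit L phi N X kappa e lambda b ->
      - (- B / a) <= energy (coords e lambda) (ctr chi) b.
    by move=> /h; rewrite -/a mulNr opprK ler_pdivrMr// mulrC.
  have [z [S [zS z0]]] := orbit_minimal_point g_standard lambda_integral c0 hC.
  have [chi_sum [sum_c sum_d sum_s]] :=
    char_shift_exists g_standard (fun j => a * (z j - ctr chi j)).
  pose chi_min := chi - chi_sum.
  have min_d : char_d chi_min = char_d chi.
    by rewrite /char_d dualD dualN -/(char_d chi_sum) sum_d subr0.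
  have min_z : energy_center L kappa e lambda chi_min = z.
    apply/funext => j; rewrite /energy_center min_d.
    rewrite {1}/char_0 dualD dualN -!/(char_0 _ _) sum_s /ctr /energy_center /a.
    by field; rewrite c0 d0.
  exists chi_min, chi_sum; split; last by rewrite /chi_min subrK.
    have min_gt0 : 0 < wt_c lambda * char_d chi_min by rewrite min_d.
    apply/eqP; rewrite eq_le; apply/andP; split.
      apply: ereal_inf_lbound; exists id; first exact: weyl_id.
      by rewrite subrr dual_0.
    apply/(inf_energy_geP g_standard c0 _ min_gt0) => b ob.
    by rewrite min_d min_z; apply: mulr_ge0; [exact: ltW|exact: z0].
  split=> //; apply/summableP; exists (a * S) => r ur.
  under eq_bigr do rewrite sum_s normrM (ger0_norm (ltW a0)).
  by rewrite -mulr_sumr ler_pM2l//; exact: zS.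
- have min_d : char_d chi_min = char_d chi.
    by rewrite chiE /char_d dualD -/(char_d chi_sum) sum_d addr0.
  have min_gt0 : 0 < wt_c lambda * char_d chi_min by rewrite min_d.
  have z0 b : weyl_orbit L phi N X kappa e lambda b ->
      0 <= energy (coords e lambda) (ctr chi_min) b.
    have : (0%:E <= inf_energy L phi N e lambda chi_min)%E by rewrite chi_min0.
    move/(inf_energy_geP g_standard c0 _ min_gt0) => h /h.
    by rewrite min_d -/a pmulr_rge0.
  have [S sumS] := (summableP _).1 sum_s.
  have zS r : uniq r -> \sum_(j <- r) `|ctr chi_min j - ctr chi j| <= S / a.
    move=> ur; rewrite ler_pdivlMr// mulr_suml.
    apply: le_trans (sumS r ur); apply: ler_sum => j _.
    rewrite -{1}(ger0_norm (ltW a0)) -normrM le_eqVlt; apply/orP; left; apply/eqP.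
    congr `|_|; rewrite /ctr /energy_center min_d chiE /a.
    have -> : char_0 (chi_min + chi_sum) (eps L kappa e j) =
      char_0 chi_min (eps L kappa e j) + char_0 chi_sum (eps L kappa e j) by [].
    by rewrite -chiE; field; rewrite c0 d0.
  have [C CE] := energy_bounded_of_summable (std_infinite g_standard)
    (period_gt0 X c0) (weyl_orbit_start L phi N X kappa e lambda)
    (@weyl_orbit_moved _ _ _ _ _ _ _ _ _ _ _)
    (weyl_orbit_pair g_standard c0)
    (@weyl_orbit_sum _ _ _ _ _ _ _ _ _ _ _) z0 zS.
  apply: (@lt_le_trans _ _ (- (a * C))%:E); first exact: ltNyr.
  apply/(inf_energy_geP g_standard c0 _ lambda_chi_gt0) => b /CE.
  by rewrite -/a -mulrN ler_pM2l.
Qed.
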